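(* Let $n\ge 2$, $k\ge 1$. For $\hat\lambda,\hat\mu\in P_k^+$ put $$\hat\lambda\circledast\hat\mu:=s_{\lambda}(a_0,a_1,\ldots,a_{n-1})\,\hat\mu ,\qquad \lambda=\mathrm P(\hat\lambda),$$ and extend bilinearly to $\mathcal H_k$. Then $(\mathcal H_k,\circledast)$ is an associative unital algebra $\mathcal F_{\mathrm{comb}}$. Moreover the product coincides with the fusion product of the level $k$ Verlinde algebra of $\widehat{\mathfrak{sl}}(n)$: for all $\hat\lambda,\hat\mu\in P_k^+$, $$\hat\lambda\circledast\hat\mu=\sum_{\hat\nu\in P_k^+}\mathcal N_{\hat\lambda\hat\mu}^{(k),\hat\nu}\,\hat\nu ,$$ so that $\mathcal F_{\mathrm{comb}}\cong\mathcal F(\widehat{\mathfrak{sl}}(n))_k$ (fusion ring with scalars extended to $\mathbb C$).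
   Context: $P_k^+$ is the set of level $k$ dominant integral weights $\hat\lambda=\sum_{i=0}^{n-1}m_i\hat\omega_i$ of $\widehat{\mathfrak{sl}}(n)$, i.e. of tuples $(m_0,\dots,m_{n-1})\in\mathbb Z_{\ge0}^n$ with $\sum m_i=k$. $\mathcal H_k$ is the complex vector space with basis $P_k^+$, $\mathcal H=\bigoplus_{k\ge0}\mathcal H_k$. $\mathrm P(\hat\lambda)$ is the partition $\lambda=(\lambda_1,\dots,\lambda_{n-1})$ with $\lambda_i-\lambda_{i+1}=m_i$ for $1\le i\le n-1$ ($\lambda_n=0$); this is a bijection from $P_k^+$ to partitions with at most $n-1$ rows and at most $k$ columns. Indices of sites are taken modulo $n$. $\varphi_i^*$ is the linear operator on $\mathcal H$ increasing $m_i$ by one; $\varphi_i$ decreases $m_i$ by one if $m_i>0$ and sends the basis vector to $0$ if $m_i=0$. Set $a_i=\varphi_{i+1}^*\varphi_i$, $i\in\mathbb Z/n\mathbb Z$; these preserve $\mathcal H_k$. For $1\le r\le n-1$ put $e_r=\sum_{|I|=r}\prod^{\circlearrowleft}_{i\in I}a_i$, sum over $r$-element subsets $I\subset\mathbb Z/n\mathbb Z$, where $\prod^{\circlearrowleft}_{i\in I}a_i$ is the product, each generator of $I$ occurring once, ordered so that $a_{i+1}$ stands to the left of $a_i$ whenever $i,i+1\in I$ (generators with non-adjacent indices commute; equivalently choose $p\notin I$ and write the factors from left to right in the order $p-1,p-2,\dots,p+1$ modulo $n$). Also $e_0=e_n=1$ and $e_r=0$ for $r<0$ or $r>n$. The $e_r$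 pairwise commute, so $s_\lambda(a_0,\dots,a_{n-1}):=\det(e_{\lambda_i^t-i+j})_{1\le i,j\le\lambda_1}$ is well defined, $\lambda^t$ being the transposed partition. The fusion ring $\mathcal F(\widehat{\mathfrak{sl}}(n))_k$ is the free $\mathbb Z$-module on $P_k^+$ with structure constants given by the Verlinde formula $$\mathcal N_{\hat\lambda\hat\mu}^{(k),\hat\nu}=\sum_{\hat\sigma\in P_k^+}\frac{\mathcal S_{\hat\lambda\hat\sigma}\mathcal S_{\hat\mu\hat\sigma}\mathcal S_{\hat\nu^*\hat\sigma}}{\mathcal S_{0\hat\sigma}},$$ where $\hat\nu^*$ is obtained from $\hat\nu=(m_0,m_1,\dots,m_{n-1})$ by replacing $m_i$ by $m_{n-i}$ for $1\le i\le n-1$ (fixing $m_0$), the index $0$ stands for the weight $k\hat\omega_0$, and $$\mathcal S_{\hat\lambda\hat\sigma}=\frac{e^{\iota\pi n(n-1)/4}}{\sqrt{n(k+n)^{n-1}}}\sum_{w\in S_n}(-1)^{\ell(w)}e^{-\frac{2\pi\iota}{k+n}(\sigma+\rho,\,w(\lambda+\rho))},\qquad \iota=\sqrt{-1},$$ where in this formula $\lambda$ denotes the vector $\sum_{i=1}^n(\lambda_i-|\lambda|/n)\varepsilon_i$ attached to the partition $\mathrm P(\hat\lambda)$ (with $\lambda_n=0$), likewise $\sigma$, $\rho=\sum_{i=1}^n(\frac{n+1}2-i)\varepsilon_i$, $(\varepsilon_i,\varepsilon_j)=\delta_{ij}$, and $S_n$ permutes the $\varepsilon_i$. *)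

(* Defs.v *)
From HB Require Import structures.
From mathcomp Require Import all_boot all_order all_algebra all_fingroup finmap.
From mathcomp Require Import monalg complex.
From mathcomp Require Import boolp reals trigo.

Set Implicit Arguments.
Unset Strict Implicit.
Unset Printing Implicit Defensive.

Import GRing.Theory Num.Theory.
Local Open Scope ring_scope.

(* The ring of linear endomorphisms of a module of arbitrary dimension; the   *)
(* product [f * g] is the composition [f \o g].                               *)
Section Endo.
Variables (K : pzRingType) (V : lmodType K).

Record endo := Endo { endo_fun :> V -> V; endo_linear : linear endo_fun }.

HB.instance Definition _ := gen_eqMixin endo.
HB.instance Definition _ := gen_choiceMixin endo.
HB.instance Definition _ (f : endo) :=
  GRing.isLinear.Build K V V *:%R (endo_fun f) (endo_linear f).

Lemma endoP (f g : endo) : (f : V -> V) =1 g -> f = g.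
Proof.
case: f g => [f fl] [g gl] /= /funext fg; case: g / fg gl => gl.
by congr Endo; apply: Prop_irrelevance.
Qed.

Fact endo0_linear : linear (fun _ : V => 0 : V).
Proof. by move=> a u v; rewrite scaler0 addr0. Qed.
Fact endoN_linear (f : endo) : linear (fun v => - f v).
Proof. by move=> a u v; rewrite linearP opprD scalerN. Qed.
Fact endoD_linear (f g : endo) : linear (fun v => f v + g v).
Proof. by move=> a u v; rewrite !linearP scalerDr addrACA. Qed.
Fact endo1_linear : linear (fun v : V => v).
Proof. by []. Qed.
Fact endoM_linear (f g : endo) : linear (f \o g).
Proof. by move=> a u v; rewrite /= !linearP. Qed.

Let add f g := Endo (endoD_linear f g).
Let opp f := Endo (endoN_linear f).
Let mul f g := Endo (endoM_linear f g).

Fact endo_addA : associative add.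
Proof. by move=> f g h; apply: endoP => v /=; rewrite addrA. Qed.
Fact endo_addC : commutative add.
Proof. by move=> f g; apply: endoP => v /=; rewrite addrC. Qed.
Fact endo_add0 : left_id (Endo endo0_linear) add.
Proof. by move=> f; apply: endoP => v /=; rewrite add0r. Qed.
Fact endo_addN : left_inverse (Endo endo0_linear) opp add.
Proof. by move=> f; apply: endoP => v /=; rewrite addNr. Qed.
HB.instance Definition _ :=
  GRing.isZmodule.Build endo endo_addA endo_addC endo_add0 endo_addN.

Fact endo_mulA : associative mul.
Proof. by move=> f g h; apply: endoP. Qed.
Fact endo_mul1 : left_id (Endo endo1_linear) mul.
Proof. by move=> f; apply: endoP. Qed.
Fact endo_mulr1 : right_id (Endo endo1_linear) mul.
Proof. by move=> f; apply: endoP. Qed.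
Fact endo_mulDl : left_distributive mul (@GRing.add endo).
Proof. by move=> f g h; apply: endoP. Qed.
Fact endo_mulDr : right_distributive mul (@GRing.add endo).
Proof. by move=> f g h; apply: endoP => v /=; rewrite linearD. Qed.
HB.instance Definition _ := GRing.Zmodule_isPzRing.Build endo
  endo_mulA endo_mul1 endo_mulr1 endo_mulDl endo_mulDr.

Lemma endo0E v : (0 : endo) v = 0. Proof. by []. Qed.
Lemma endo1E v : (1 : endo) v = v. Proof. by []. Qed.
Lemma endoNE (f : endo) v : (- f) v = - f v. Proof. by []. Qed.
Lemma endoDE (f g : endo) v : (f + g) v = f v + g v. Proof. by []. Qed.
Lemma endoME (f g : endo) v : (f * g) v = f (g v). Proof. by []. Qed.
End Endo.

Record unital_algebra (K : pzRingType) (V : lmodType K) (mul : V -> V -> V)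
    : Prop := UnitalAlgebra {
  unital_algebra_linear_l : forall v, linear (mul^~ v);
  unital_algebra_linear_r : forall u, linear (mul u);
  unital_algebra_assoc : associative mul;
  unital_algebra_unit : exists one, left_id one mul /\ right_id one mul }.

Notation state n := {ffun 'I_n -> nat}.

Record weight (n k : nat) := Weight {
  weight_state :> state n;
  weight_level : (\sum_i weight_state i)%N == k }.

HB.instance Definition _ n k := [isSub for @weight_state n k].
HB.instance Definition _ n k := [Choice of weight n k by <:].
HB.instance Definition _ n k := [Countable of weight n k by <:].

Definition weight_code n k (w : weight n k) : {ffun 'I_n -> 'I_k.+1} :=
  [ffun i => inord (w i)].
Definition weight_decode n k (h : {ffun 'I_n -> 'I_k.+1}) :
  option (weight n k) := insub [ffun i => h i : nat].
Fact weight_codeK n k : pcancel (@weight_code n k) (@weight_decode n k).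
Proof.
move=> w; rewrite /weight_decode.
rewrite (_ : [ffun i => _] = val w) ?valK //.
apply/ffunP=> i; rewrite !ffunE inordK // ltnS.
by rewrite -[leqRHS](eqP (weight_level w)) (bigD1 i) //= leq_addr.
Qed.
HB.instance Definition _ n k : isFinite (weight n k) :=
  PCanIsFinite (@weight_codeK n k).

Section Partition.
Variable n : nat.

(* [m_i] is [m i] for [i : 'I_n]; the entry of index i is
   lambda_(i+1) = m_(i+1) + ... + m_(n-1). *)
Definition partition_of (m : state n) : seq nat :=
  mkseq (fun i => \sum_(j < n | (i < j)%N) m j)%N n.-1.

(* [tpart lam j] is the (j+1)-th part of the transposed partition. *)
Definition tpart (lam : seq nat) (j : nat) : nat :=
  count (fun l => (j < l)%N) lam.
End Partition.

Section Phase.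
Variables (K : fieldType) (n : nat).

(* The basis is the set of all n-tuples, i.e. the union over k of the weights
   of level k, so this is the direct sum of the level spaces. *)
Definition fock : lmodType K := {malg K[state n]}.
Definition ket (m : state n) : fock := << m >>.

Section LinearExtension.
Variable f : state n -> fock.

Definition linext_fun (v : fock) : fock := \sum_(m <- msupp v) v@_m *: f m.

Lemma linext_funEw (v : fock) (d : {fset state n}) :
  (msupp v `<=` d)%fset -> linext_fun v = \sum_(m <- d) v@_m *: f m.
Proof.
move=> vd; rewrite /linext_fun; apply: big_fset_incl => // m _ mNv.
by rewrite mcoeff_outdom // scale0r.
Qed.

Fact linext_linear : linear linext_fun.
Proof.
move=> a u v; pose d := (msupp u `|` msupp v)%fset.
have du : (msupp u `<=` d)%fset by apply: fsubsetUl.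
have dv : (msupp v `<=` d)%fset by apply: fsubsetUr.
have duv : (msupp (a *: u + v) `<=` d)%fset.
  apply/fsubsetP=> m; apply: contraLR; rewrite in_fsetU negb_or => /andP[mu mv].
  by rewrite -mcoeff_eq0 mcoeffD mcoeffZ !mcoeff_outdom // mulr0 addr0.
rewrite (linext_funEw duv) (linext_funEw du) (linext_funEw dv) scaler_sumr.
rewrite -big_split; apply: eq_bigr => m _ /=.
by rewrite mcoeffD mcoeffZ scalerDl scalerA.
Qed.

Definition linext : endo fock := Endo linext_linear.

Lemma linextE m : linext (ket m) = f m.
Proof.
rewrite /= (linext_funEw msuppU_le) big_seq_fset1.
by rewrite /ket mcoeffUU scale1r.
Qed.
End LinearExtension.

Definition phi_star (i : 'I_n) : endo fock :=
  linext (fun m => ket [ffun j => m j + (j == i)]%N).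

Definition phi (i : 'I_n) : endo fock :=
  linext (fun m => if m i == 0%N then 0 else ket [ffun j => m j - (j == i)]%N).

(* [ordS] and [ord_pred] are the cyclic successor and predecessor on ['I_n]. *)
Definition hop (i : 'I_n) : endo fock := phi_star (ordS i) * phi i.

(* The factors are p-1, p-2, ..., p+1 from left to right, for some p not in I.
   The value at the full set is never used. *)
Definition cyclic_prod (I : {set 'I_n}) : endo fock :=
  if [pick p | p \notin I] is Some p then
    \prod_(i <- traject (@ord_pred n) (ord_pred p) n.-1 | i \in I) hop i
  else 1.

Definition elem_sym (r : int) : endo fock :=
  if r is Posz r then
    if (r == 0%N) || (r == n) then 1
    else \sum_(I : {set 'I_n} | #|I| == r) cyclic_prod I
  else 0.

(* Row i and column j of the matrix are numbered from 0, which leaves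
   the difference j - i unchanged. *)
Definition schur (lam : seq nat) : endo fock :=
  \det (\matrix_(i < head 0%N lam, j < head 0%N lam)
    elem_sym ((tpart lam i)%:Z - i%:Z + j%:Z)).

Section Level.
Variable k : nat.

Definition level_pred : {pred fock} :=
  fun v => all (fun m : state n => \sum_i m i == k)%N (msupp v).

Lemma level_predP (v : fock) :
  reflect (forall m : state n, v@_m != 0 -> (\sum_i m i)%N = k)
          (v \in level_pred).
Proof.
apply: (iffP allP) => vk m; last by rewrite -mcoeff_neq0 => /vk/eqP.
by rewrite mcoeff_neq0 => /vk/eqP.
Qed.

Fact level_submod : submod_closed level_pred.
Proof.
split=> [|a u v /level_predP uk /level_predP vk].
  by apply/level_predP => m; rewrite mcoeff0 eqxx.
apply/level_predP => m; rewrite mcoeffD mcoeffZ.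
have [->|/uk//] := eqVneq u@_m 0; rewrite mulr0 add0r; exact: vk.
Qed.
HB.instance Definition _ :=
  GRing.isSubmodClosed.Build K fock level_pred level_submod.

Record level_space := LevelSpace {
  level_val :> fock; level_valP : level_val \in level_pred }.
HB.instance Definition _ := [isSub for level_val].
HB.instance Definition _ := [Choice of level_space by <:].
HB.instance Definition _ := [SubChoice_isSubLmodule of level_space by <:].

Fact wket_level (w : weight n k) : ket w \in level_pred.
Proof.
apply/level_predP => m; rewrite mcoeffU; have [<- _|_] := eqVneq _ m.
  exact/eqP/weight_level.
by rewrite eqxx.
Qed.
Definition wket (w : weight n k) : level_space := LevelSpace (wket_level w).

Definition preserves (f : endo fock) :=
  forall v, v \in level_pred -> f v \in level_pred.

Lemma preserves0 : preserves 0. Proof. by move=> v _; apply: rpred0. Qed.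
Lemma preserves1 : preserves 1. Proof. by []. Qed.
Lemma preservesD f g : preserves f -> preserves g -> preserves (f + g).
Proof. by move=> pf pg v vk; apply: rpredD; [apply: pf|apply: pg]. Qed.
Lemma preservesN f : preserves f -> preserves (- f).
Proof. by move=> pf v vk; rewrite endoNE rpredN; apply: pf. Qed.
Lemma preservesM f g : preserves f -> preserves g -> preserves (f * g).
Proof. by move=> pf pg v /pg/pf. Qed.

Lemma hopE i m : hop i (ket m) =
  if m i == 0%N then 0
  else ket [ffun j => m j - (j == i) + (j == ordS i)]%N.
Proof.
rewrite endoME linextE; case: eqP => _; first by rewrite linear0.
by rewrite linextE; congr ket; apply/ffunP => j; rewrite !ffunE.
Qed.

Lemma hop_preserves i : preserves (hop i).
Proof.
move=> v /level_predP vk.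
have -> : hop i v = \sum_(m <- msupp v) v@_m *: hop i (ket m).
  rewrite {1}[v]monalgE linear_sum; apply: eq_bigr => m _.
  have <- : hop i (v@_m *: ket m) = v@_m *: hop i (ket m) by exact: linearZ.
  by congr (hop i _); apply/malgP => m'; rewrite mcoeffZ !mcoeffU mulrnAr mulr1.
apply: rpred_sum => m _.
have [->|/vk mk] := eqVneq v@_m 0; first by rewrite scale0r rpred0.
apply: rpredZ; rewrite hopE; case: ifP => [_|/negbT mi]; first exact: rpred0.
apply/level_predP => m'; rewrite mcoeffU.
have [<- _|_] := eqVneq _ m'; last by rewrite eqxx.
under eq_bigr do rewrite ffunE.
have S1 : (\sum_(j < n) (j == ordS i) = 1)%N.
  by rewrite (bigD1 (ordS i)) //= eqxx big1 // => j /negbTE ->.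
rewrite big_split /= S1 (bigD1 i) //= eqxx.
rewrite (eq_bigr m) => [|j /negbTE ->]; last by rewrite subn0.
by rewrite -mk [in RHS](bigD1 i) //= addnAC subnK // lt0n.
Qed.

Lemma elem_preserves r : preserves (elem_sym r).
Proof.
case: r => r /=; last exact: preserves0.
case: ifP => _; first exact: preserves1.
apply: (big_ind preserves) => [||I _]; [exact: preserves0|exact: preservesD|].
rewrite /cyclic_prod; case: pickP => [p _|_]; last exact: preserves1.
apply: (big_ind preserves) => [||i _]; [exact: preserves1|exact: preservesM|].
exact: hop_preserves.
Qed.

Lemma schur_preserves lam : preserves (schur lam).
Proof.
apply: (big_ind preserves) => [||s _]; [exact: preserves0|exact: preservesD|].
apply: preservesM.
  by case: (odd_perm s); rewrite ?expr1 ?expr0;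
    [apply: preservesN|]; apply: preserves1.
apply: (big_ind preserves) => [||i _]; [exact: preserves1|exact: preservesM|].
by rewrite mxE; apply: elem_preserves.
Qed.

Definition level_op (lam : seq nat) (v : level_space) : level_space :=
  LevelSpace (schur_preserves lam (level_valP v)).

Definition comb_mul (u v : level_space) : level_space :=
  \sum_(w : weight n k)
    (u : fock)@_(w : state n) *: level_op (partition_of w) v.

Lemma comb_mul_wket (w w' : weight n k) :
  comb_mul (wket w) (wket w') = level_op (partition_of w) (wket w').
Proof.
rewrite /comb_mul (bigD1 w) //= mcoeffUU scale1r big1 ?addr0 // => w1 w1w.
by rewrite mcoeffU eq_sym [_ == _](negbTE w1w) scale0r.
Qed.
End Level.
End Phase.

Section Verlinde.
Variable R : realType.

(* e^(it) *)
Definition cis (t : R) : R[i] := (cos t +i* sin t)%C.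

Section Smatrix.
Variables (n k : nat).

Definition partition_vec (m : state n) : 'rV[R]_n :=
  \row_i ((nth 0%N (partition_of m) i)%:R
          - (sumn (partition_of m))%:R / n%:R).

(* The coordinate of index i is that of epsilon_(i+1). *)
Definition rho : 'rV[R]_n := \row_(i < n) (n.+1%:R / 2 - i.+1%:R).

Definition perm_act (w : 'S_n) (v : 'rV[R]_n) : 'rV[R]_n :=
  \sum_i v 0 i *: delta_mx 0 (w i).

Definition dot (u v : 'rV[R]_n) : R := \sum_i u 0 i * v 0 i.

Definition Smx (m s : state n) : R[i] :=
  cis (pi * (n * n.-1)%:R / 4)
  / ((Num.sqrt (n * (k + n) ^ n.-1)%:R)%:C)%C
  * \sum_(w : 'S_n) (-1) ^+ w *
      cis (- (2 * pi / (k + n)%:R)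
           * dot (partition_vec s + rho) (perm_act w (partition_vec m + rho))).

(* [ordS (rev_ord i)] is n - i for i > 0, and 0 for i = 0. *)
Definition dual_state (m : state n) : state n :=
  [ffun i => m (ordS (rev_ord i))].

Definition vacuum : state n := [ffun i : 'I_n => if i == 0 :> nat then k else 0%N].

Definition verlinde (l m v : weight n k) : R[i] :=
  \sum_(s : weight n k)
    Smx l s * Smx m s * Smx (dual_state v) s / Smx vacuum s.
End Smatrix.
End Verlinde.

(* The bilinear product on the free K-module on the finite set T with
   structure constants N. If N is integral, the product over K with constants
   (N l m s)%:~R is the scalar extension to K of the product over int. *)
Definition structure_mul (K : comNzRingType) (T : finType)
    (N : T -> T -> T -> K) (u v : {malg K[T]}) : {malg K[T]} :=
  \sum_l \sum_m \sum_s << u@_l * v@_m * N l m s *g s >>.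

(* Main.v *)
Require Import Defs.
From HB Require Import structures.
From mathcomp Require Import all_boot all_order all_algebra all_fingroup finmap.
From mathcomp Require Import monalg complex.
From mathcomp Require Import boolp reals trigo.
From mathcomp Require Import zify ring lra.

Set Implicit Arguments.
Unset Strict Implicit.
Unset Printing Implicit Defensive.

Import Order.TTheory GRing.Theory Num.Theory.
Local Open Scope ring_scope.

(** The product is diagonalised by the determinants that make up the S-matrix. Put N = k + n.
    For a state m let l_j = lambda_(j+1) + n - 1 - j, for 0 <= j < n, be the beta numbers of its
    partition ([beta]). For a weight s put y_i = exp (- 2 pi sqrt(-1) (s + rho)_i / N) ([node]).
    Then S_(m,s) is a constant times psi_s(m) = det (y_i ^ l_j) ([SmxE], where psi_s(m) is
    [char_val]).

    Eigenvalues. The y_i have product 1 and a common N-th power. By the Pieri rule, e_r(y) psi_s(m)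
    is the sum over the r-element sets I of the determinants det (y_i ^ (l_j + 1_I(j))). Such a
    determinant is psi_s of the state obtained from m by letting the particles of I hop: if
    a hop crosses from site n - 1 to site 0, a full column has to be removed, and the product of
    the y_i is 1; if a hop is blocked by an empty site i > 0, two columns are equal; if it is
    blocked by the empty site 0, two columns are proportional since y_i ^ N does not depend on i.
    So psi_s (e_r v) = e_r(y) psi_s(v) on level k ([eigenfun_elem_sym]), and psi_s (s_lambda(a) v)
    = s_lambda(y) psi_s(v). The dual Jacobi-Trudi formula, proved by comparing complementary
    minors of a Vandermonde matrix ([dual_jacobi_trudi]), says that s_lambda(y) is the quotient
    psi_s(lambda) / psi_s(0). Hence the psi_s / psi_s(0) are multiplicative for the
    combinatorial product ([chi_comb_mul]).

    Orthogonality. The sum over s of psi_s(u) times the conjugate of psi_s(v) is n N^(n-1) if u = v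
    and 0 otherwise ([slater_orthogonal]). Write |u| for the sum of the beta numbers of u. If n
    does not divide |u| - |v|, rotating the weight s multiplies the summand by a root of unity
    different from 1. If it does, the weights
    together with the permutations parametrise the injective sequences in 0, ..., N-1 that
    contain 0, and the sum over all sequences with a prescribed entry 0 is a combination of
    products of geometric sums.

    Conclusion. By orthogonality the psi_s separate vectors, which reduces associativity and the
    unit laws to identities between complex numbers, and the coefficients of a vector are
    recovered from its psi_s by the sum of the Verlinde formula. The coefficients are integers
    because the operators a_i have integer matrices, so the Verlinde numbers define a ring over
    the integers whose scalar extension is the combinatorial algebra. *)

(** * Signs of permutations *)
Section Sign.

(** Permuting the columns of the Vandermonde matrix of 0, 1, ..., n-1 multiplies its
    determinant by the sign of s, and the product formula for the two determinants
    shows that this factor is the product of the signs of the s j - s i. *)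
Lemma sign_perm_prod (F : comPzRingType) n (s : 'S_n) :
  (-1) ^+ s
  = \prod_(i < n) \prod_(j < n | (i < j)%N) (if (s j < s i)%N then -1 else 1) :> F.
Proof.
pose V (a : 'I_n -> int) := Vandermonde n (\row_j a j).
pose D := \det (V (fun j => (j : nat)%:Z)).
have D_gt0 : 0 < D.
  rewrite /D det_Vandermonde; apply: prodr_gt0 => i _; apply: prodr_gt0 => j ij.
  by rewrite !mxE subr_gt0 ltz_nat.
have sD : \det (V (fun j => (s j : nat)%:Z)) = (-1) ^+ s * D.
  rewrite /D; have -> : V (fun j => (s j : nat)%:Z) = col_perm s (V (fun j => (j : nat)%:Z)).
    by apply/matrixP=> i j; rewrite !mxE.
  by rewrite col_permE det_mulmx det_perm odd_permV mulrC.
have sZ : (-1) ^+ s = \prod_(i < n) \prod_(j < n | (i < j)%N)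
    (if (s j < s i)%N then -1 else 1) :> int.
  transitivity (sgz (\det (V (fun j => (s j : nat)%:Z)))).
    by rewrite sD sgzM (gtr0_sgz D_gt0) mulr1; case: (odd_perm s).
  have sgzP (I : finType) (P : pred I) (f : I -> int) :
      sgz (\prod_(i | P i) f i) = \prod_(i | P i) sgz (f i).
    exact: (big_morph (@sgz int) (@sgzM int) (@sgz1 int)).
  rewrite det_Vandermonde sgzP; apply: eq_bigr => i _.
  rewrite sgzP; apply: eq_bigr => j ij; rewrite !mxE.
  have : s j != s i by rewrite (inj_eq perm_inj) eq_sym neq_ltn ij.
  rewrite -val_eqE neq_ltn /=; case: ltngtP => // sij _.
    by rewrite ltr0_sgz // subr_lt0 ltz_nat.
  by rewrite gtr0_sgz // subr_gt0 ltz_nat.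
rewrite -[LHS](rmorph_sign (intmul 1 : int -> F)) sZ rmorph_prod; apply: eq_bigr => i _.
by rewrite rmorph_prod; apply: eq_bigr => j _; case: ifP => _; rewrite ?rmorphN1 ?rmorph1.
Qed.

Definition rev_perm n : 'S_n := perm (@rev_ord_inj n).

Lemma sign_rev_perm (F : comPzRingType) n :
  (-1) ^+ rev_perm n = (-1) ^+ (n * n.-1)./2 :> F.
Proof.
rewrite sign_perm_prod (exchange_big_dep predT) //=.
transitivity (\prod_(j < n) (-1) ^+ j : F).
  apply: eq_bigr => j _.
  rewrite -[X in _ ^+ X]card_ord -prodr_const (big_ord_narrow (ltnW (ltn_ord j))) /=.
  apply: eq_bigr => i _; rewrite !permE /= ifT // ltn_sub2l ?ltnS //=.
  exact: leq_ltn_trans (ltn_ord i) (ltn_ord j).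
by rewrite prodrXr -bin2 -bin2_sum big_mkord.
Qed.
End Sign.

(** * Elementary symmetric polynomials *)
Section ElementarySymmetric.
Variables (F : comNzRingType) (n : nat) (y : 'I_n -> F).

(** The degree is an integer so that the entries of a Jacobi-Trudi determinant can be
    written without side conditions; degrees outside 0, ..., n give 0. *)
Definition esp (r : int) : F :=
  if r is Posz r then \sum_(I : {set 'I_n} | #|I| == r) \prod_(i in I) y i else 0.

Lemma esp0 : esp 0 = 1.
Proof.
rewrite -[0]/(Posz 0) /esp (big_pred1 set0) ?big_set0 // => I.
by rewrite cards_eq0.
Qed.

Lemma esp_gt (r : nat) : (n < r)%N -> esp r = 0.
Proof.
move=> nr; rewrite /esp big1 // => I /eqP Ir.
by have := max_card (mem I); rewrite card_ord Ir leqNgt nr.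
Qed.

Lemma esp_full : esp n = \prod_i y i.
Proof.
rewrite /esp (big_pred1 setT) => [|I]; first by apply: eq_bigl => i; rewrite inE.
rewrite /= eqEcard subsetT cardsT card_ord eqn_leq.
by rewrite -[n in (_ <= n)%N && _]card_ord max_card.
Qed.

Lemma coef_prod_XsubC (c : nat) :
  (\prod_(i < n) ('X - (y i)%:P))`_c = (-1) ^+ (n + c) * esp (n%:Z - c%:Z).
Proof.
have -> : \prod_(i < n) ('X - (y i)%:P)
    = \sum_(J : {set 'I_n}) ((-1) ^+ #|J| * \prod_(i in J) y i)%:P * 'X^(n - #|J|).
  under eq_bigr do rewrite addrC.
  rewrite bigA_distr; apply: eq_bigr => J _.
  rewrite (big_if _ _ predT) /=.
  congr (_ * _).
    by rewrite polyCM rmorphXn rmorphN1 rmorph_prod -prodrN.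
  rewrite (eq_bigl (fun i => i \in ~: J)) => [|i]; last by rewrite inE.
  rewrite prodr_const; congr (_ ^+ _).
  by rewrite cardsCs setCK card_ord.
rewrite coef_sum.
under eq_bigr do rewrite coefCM coefXn.
have card_le (J : {set 'I_n}) : (#|J| <= n)%N by rewrite -[n in leqRHS]card_ord max_card.
case: (leqP c n) => [cn|nc].
  rewrite subzn // [esp _]/= (bigID (fun J : {set 'I_n} => #|J| == n - c)%N) /=.
  rewrite [X in _ + X]big1 ?addr0.
    rewrite mulr_sumr /=; apply: eq_bigr => J /eqP ->.
    by rewrite subKn // eqxx mulr1 -signr_odd oddB // -oddD signr_odd.
  move=> J Jc; suff -> : (c == n - #|J|)%N = false by rewrite mulr0.
  move: (#|J|) (card_le J) Jc => q; lia.
rewrite big1 => [|J _].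
  have : n%:Z - c%:Z < 0 by lia.
  by case: (n%:Z - c%:Z) => // d _; rewrite mulr0.
by rewrite gtn_eqF ?mulr0 // (leq_ltn_trans (leq_subr _ _)).
Qed.

End ElementarySymmetric.

(** * The dual Jacobi-Trudi formula *)
Lemma sum_leq_ord n a : (\sum_(i < n) (a <= i)%N = n - a)%N.
Proof.
by elim: n => [|n IH]; rewrite ?big_ord0 // big_ord_recr /= IH; case: leqP; lia.
Qed.

Lemma det_scale_sign (F : comPzRingType) n (a b : 'I_n -> nat) (M : 'M[F]_n) :
  \det (\matrix_(i, j) ((-1) ^+ (a i + b j) * M i j))
  = (-1) ^+ (\sum_i a i + \sum_i b i) * \det M.
Proof.
rewrite /determinant mulr_sumr; apply: eq_bigr => s _.
under eq_bigr do rewrite mxE.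
rewrite big_split /= mulrCA; congr (_ * (_ * _)).
rewrite prodrXr big_split /=; congr (_ ^+ (_ + _)).
by rewrite [RHS](reindex_inj (@perm_inj _ s)).
Qed.

(** Complementary minors. For monic P of degree n with roots y_i, the polynomials P X^j
    with j < p span the kernel of evaluation at the y_i on polynomials of degree less than
    n + p. Maximal minors of the evaluation matrix are therefore proportional, up to sign,
    to the complementary minors of the matrix of coefficients of the P X^j, whose entries
    are signed elementary symmetric polynomials. The set of exponents mu_a + a and its
    complement, the set of the n + b - c_b, are read off from the partition mu and its
    transpose c. The parts of mu are listed in increasing order, which makes a |-> mu_a + a
    increasing. *)
Section DualJacobiTrudi.
Variables (F : comNzRingType) (n p : nat) (y : 'I_n -> F) (mu : 'I_n -> nat).
Hypothesis mu_homo : forall a b : 'I_n, (a <= b)%N -> (mu a <= mu b)%N.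
Hypothesis mu_le : forall a, (mu a <= p)%N.

Let c (b : nat) : nat := \sum_(a < n) (b < mu a)%N.

Let c_le b : (c b <= n)%N.
Proof.
rewrite -[n in leqRHS]card_ord -sum1_card; apply: leq_sum => a _; exact: leq_b1.
Qed.

(* A cell lies in the diagram iff its row is long enough, iff its column is: with the rows in
   increasing order, column b consists of the last c b rows. *)
Let box_duality (a : 'I_n) b : (b < mu a)%N = (n <= a + c b)%N.
Proof.
case: (leqP (mu a) b) => [mb|bm].
  have : (c b <= n - a.+1)%N.
    rewrite -sum_leq_ord; apply: leq_sum => i _.
    case: (ltnP a i) => [_|/mu_homo mi]; first exact: leq_b1.
    by rewrite ltnNge (leq_trans mi mb).
  by have := ltn_ord a; lia.
have : (n - a <= c b)%N.
  rewrite -sum_leq_ord; apply: leq_sum => i _; case: (leqP a i) => // /mu_homo mi.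
  by rewrite (leq_trans bm mi).
by have := ltn_ord a; lia.
Qed.

Let l (a : 'I_n) : nat := mu a + a.
Let m (b : 'I_p) : nat := n + b - c b.

Let l_lt a : (l a < n + p)%N.
Proof. by have := mu_le a; have := ltn_ord a; rewrite /l; lia. Qed.
Let m_lt b : (m b < n + p)%N.
Proof. by have := ltn_ord b; rewrite /m; lia. Qed.

Let lt_m_l a b : (m b < l a)%N = (b < mu a)%N.
Proof.
have := box_duality a b; have := c_le b; have := ltn_ord a.
by rewrite /l /m; case: (ltnP b (mu a)) => bm ? ? /esym; lia.
Qed.

Let lt_l_m a b : (l a < m b)%N = ~~ (b < mu a)%N.
Proof.
have := box_duality a b; have := c_le b; have := ltn_ord a.
by rewrite /l /m; case: (ltnP b (mu a)) => bm ? ? /esym; lia.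
Qed.

Let l_homo (a a' : 'I_n) : (a < a')%N -> (l a < l a')%N.
Proof. by move=> aa'; have := mu_homo (ltnW aa'); rewrite /l; lia. Qed.

Let m_homo (b b' : 'I_p) : (b < b')%N -> (m b < m b')%N.
Proof.
move=> bb'; have : (c b' <= c b)%N.
  apply: leq_sum => a _; case: (ltnP b' (mu a)) => // /(ltn_trans bb') ->.
  by [].
by have := c_le b; have := c_le b'; rewrite /m; lia.
Qed.

(* The exponents of mu followed by their complement: the inversions of this shuffle are
   exactly the cells of the diagram, since m b < l a amounts to b < mu a. *)
Let f (i : 'I_(n + p)) : 'I_(n + p) :=
  match split i with inl a => Ordinal (l_lt a) | inr b => Ordinal (m_lt b) end.

Let fl a : f (lshift p a) = l a :> nat.
Proof. by rewrite /f (unsplitK (inl a)). Qed.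
Let fr b : f (rshift n b) = m b :> nat.
Proof. by rewrite /f (unsplitK (inr b)). Qed.

Let f_inj : injective f.
Proof.
move=> i j /(congr1 val) /=.
case: (split_ordP i) => a ->; case: (split_ordP j) => b ->; rewrite ?fl ?fr => fE.
- congr lshift; apply: val_inj; case: (ltngtP a b) => // /l_homo; lia.
- by move: (lt_m_l a b) (lt_l_m a b); rewrite fE !ltnn => <-.
- by move: (lt_m_l b a) (lt_l_m b a); rewrite fE !ltnn => <-.
- congr rshift; apply: val_inj; case: (ltngtP a b) => // /m_homo; lia.
Qed.

Let pi := perm f_inj.

Let sign_pi : (-1) ^+ pi = (-1) ^+ (\sum_(b < p) c b) :> F.
Proof.
rewrite sign_perm_prod big_split_ord /= [X in _ * X]big1 ?mulr1; last first.
  move=> b _; rewrite big1 // => j; case: (split_ordP j) => [a ->|b' ->] /= bj.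
    by have := ltn_ord a; lia.
  by rewrite !permE !fr ltnNge (ltnW (m_homo _)) // -(ltn_add2l n).
rewrite [in RHS]exchange_big /= -prodrXr; apply: eq_bigr => a _.
rewrite big_split_ord /= big1 ?mul1r => [|a' aa'].
  rewrite -prodrXr; apply: eq_big => [b|b _].
    by rewrite (leq_trans (ltn_ord a)) ?leq_addr.
  by rewrite !permE fl fr lt_m_l; case: ifP.
by rewrite !permE !fl ltnNge (ltnW (l_homo _)).
Qed.

Let P := \prod_(i < n) ('X - (y i)%:P).

Let coefPX j d :
  (P * 'X^j)`_d = (-1) ^+ (n + d + j) * esp y (n%:Z - d%:Z + j%:Z).
Proof.
rewrite coefMXn coef_prod_XsubC; case: ltnP => [dj|jd].
  rewrite (_ : _ + _ = Posz (n + j - d)); last by lia.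
  by rewrite esp_gt ?mulr0 //; lia.
congr (_ * esp y _); last by lia.
rewrite -signr_odd -[in RHS]signr_odd; congr (_ ^+ nat_of_bool _); lia.
Qed.

Let V (h : 'I_n -> nat) := \matrix_(i < n, j < n) y i ^+ h j.
Let ev := \matrix_(i < n, j < n + p) y i ^+ j.
(* X stacks the evaluation matrix on the coordinate rows of the complement, and Z completes
   the coefficients of the P X^j to a unitriangular matrix. In X Z the evaluations of
   the P X^j vanish. *)
Let X := col_mx ev (\matrix_(b < p, j < n + p) (j == m b :> nat)%:R).
Let Z := row_mx (\matrix_(i < n + p, j < n) (i == j :> nat)%:R)
                (\matrix_(i < n + p, j < p) (P * 'X^j)`_i).

Let detX : \det (V l) = (-1) ^+ (\sum_(b < p) c b) * \det X.
Proof.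
have -> : \det (V l) = \det (col_perm pi X).
  have -> : col_perm pi X = block_mx (V l) (\matrix_(i, j) y i ^+ m j) 0 1%:M.
    rewrite -[LHS]submxK; congr block_mx; apply/matrixP => i j;
      rewrite !mxE permE ?(unsplitK (inl i)) ?(unsplitK (inr i)) mxE ?fl ?fr //.
      move: (lt_l_m j i) (lt_m_l j i); case: eqP => // ->.
      by rewrite !ltnn => ni i1; rewrite -i1 in ni.
    congr (_%:R); congr nat_of_bool; apply/eqP/eqP => [mm|-> //].
    by apply: val_inj; case: (ltngtP i j) => // /m_homo; lia.
  by rewrite det_ublock det1 mulr1.
by rewrite col_permE det_mulmx det_perm odd_permV sign_pi mulrC.
Qed.

Let detZ : \det Z = 1.
Proof.
have -> : Z = block_mx 1%:M (usubmx (\matrix_(i < n + p, j < p) (P * 'X^j)`_i)) 0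
   (\matrix_(i < p, j < p) (P * 'X^j)`_(n + i)).
  rewrite -[LHS]submxK; congr block_mx; apply/matrixP => i j; rewrite !mxE.
  - by rewrite (unsplitK (inl j)) mxE /= (inj_eq val_inj).
  - by rewrite (unsplitK (inr j)) !mxE.
  - rewrite (unsplitK (inl j)) mxE /=; case: eqP => // ij.
    by have := ltn_ord j; lia.
  - by rewrite (unsplitK (inr j)) mxE.
rewrite det_ublock det1 mul1r -det_tr det_trig => [|].
  rewrite big1 // => i _; rewrite !mxE coefPX.
  rewrite (_ : _ + _ = 0); last by lia.
  by rewrite esp0 mulr1 -signr_odd (_ : odd _ = false) //; lia.
apply/is_trig_mxP => i j ij; rewrite !mxE coefPX.
rewrite (_ : _ + _ = Negz (j - i.+1)); last by lia.
by rewrite mulr0.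
Qed.

Lemma dual_jacobi_trudi_incr :
  \det (\matrix_(i < n, j < n) y i ^+ (mu j + j))
  = \det (\matrix_(b < p, b' < p) esp y ((c b)%:Z - b%:Z + b'%:Z))
    * \det (\matrix_(i < n, j < n) y i ^+ j).
Proof.
set E := (X in _ = \det X * _).
have XZ : \det (X *m Z) = \det (V (fun j => j)) * ((-1) ^+ (\sum_(b < p) c b) * \det E).
  pose U := \matrix_(b < p, j < p) ((-1) ^+ (c b + b + j) * E b j).
  pose W := \matrix_(b < p, j < n) (m b == j)%:R : 'M[F]_(p, n).
  have -> : X *m Z = block_mx (V (fun j => j)) 0 W U.
    rewrite mul_col_row; congr block_mx; apply/matrixP => i j; rewrite !mxE.
    - rewrite (bigD1 (lshift p j)) //= !mxE eqxx mulr1 big1 ?addr0 // => k kj.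
      by rewrite !mxE [_ == _ :> nat](negbTE kj) mulr0.
    - under eq_bigr do rewrite !mxE mulrC.
      rewrite -horner_coef_wide; last first.
        (* P X^j has degree n + j, less than n + p *)
        rewrite (leq_trans (size_polyMleq _ _)) // size_polyXn size_prod_XsubC.
        rewrite [index_enum _]unlock -enumT size_enum_ord; have := ltn_ord j; lia.
      by rewrite hornerM /P horner_prod (bigD1 i) //= hornerXsubC subrr !mul0r.
    - rewrite (bigD1 (Ordinal (m_lt i))) //= !mxE eqxx mul1r big1 ?addr0 // => k ki.
      by rewrite !mxE [_ == _ :> nat](negbTE ki) mul0r.
    - rewrite (bigD1 (Ordinal (m_lt i))) //= !mxE eqxx mul1r big1 ?addr0 => [|k ki].
        rewrite coefPX; congr (_ * esp y _); last by have := c_le i; rewrite /= /m; lia.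
        rewrite -signr_odd -[in RHS]signr_odd; congr (_ ^+ nat_of_bool _).
        by have := c_le i; rewrite /= /m; lia.
      by rewrite !mxE [_ == _ :> nat](negbTE ki) mul0r.
  rewrite det_lblock det_scale_sign big_split /=; congr (_ * (_ * _)).
  rewrite -signr_odd -[in RHS]signr_odd; congr (_ ^+ nat_of_bool _); lia.
move: XZ; rewrite det_mulmx detZ mulr1 => XE.
by have := detX; rewrite XE mulrCA signrMK mulrC.
Qed.
End DualJacobiTrudi.

(** * Beta numbers and alternants *)
Section Beta.
Variable n : nat.
Implicit Type m : state n.

(** The beta numbers lambda_(j+1) + n - 1 - j of the partition lambda of m. In this form they are
    affine functions of the occupation numbers, so that the effect of a hop is explicit. They
    strictly decrease for j < n and end with 0 at j = n - 1. *)
Definition beta m (j : nat) : nat := \sum_(i < n | (j < i)%N) (m i).+1.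

Lemma nth_partition_of m j :
  nth 0%N (partition_of m) j = (\sum_(i < n | (j < i)%N) m i)%N.
Proof.
case: (ltnP j n.-1) => [jn|nj]; first by rewrite nth_mkseq.
rewrite nth_default ?size_mkseq // big_pred0 // => i.
by have := ltn_ord i; lia.
Qed.

Lemma sum_ltn_ord j : (\sum_(i < n | (j < i)%N) 1 = n.-1 - j)%N.
Proof.
have -> : (n.-1 - j = n - j.+1)%N by lia.
by rewrite -sum_leq_ord big_mkcond.
Qed.

Lemma beta_partition m j : beta m j = (nth 0%N (partition_of m) j + (n.-1 - j))%N.
Proof.
rewrite /beta nth_partition_of -sum_ltn_ord -big_split /=.
by apply: eq_bigr => i _; rewrite addn1.
Qed.

Lemma partition_of_homo m i j : (i <= j)%N ->
  (nth 0%N (partition_of m) j <= nth 0%N (partition_of m) i)%N.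
Proof.
move=> ij; rewrite !nth_partition_of big_mkcond [leqRHS]big_mkcond.
by apply: leq_sum => a _; case: (ltnP j a) => // ja; rewrite (leq_ltn_trans ij ja).
Qed.

Lemma tpart_sum m b :
  tpart (partition_of m) b = (\sum_(a < n) (b < nth 0%N (partition_of m) a))%N.
Proof.
rewrite /tpart -sum1_count (big_nth 0%N) size_mkseq big_mkord big_mkcond /=.
case: n m => [|q] m; first by rewrite !big_ord0.
rewrite [RHS]big_ord_recr /= [X in (_ + X)%N](_ : _ = 0%N) ?addn0.
  by apply: eq_bigr => a _; case: ltnP.
by rewrite nth_default ?size_mkseq.
Qed.

(** For e = beta m and e = (n-1, ..., 1, 0) these are numerator and denominator of the
    bialternant formula for the Schur polynomial of m. *)
Definition alternant (F : pzRingType) (y : 'I_n -> F) (e : 'I_n -> nat) : F :=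
  \det (\matrix_(i, j) y i ^+ e j).

Lemma alternant_perm (F : comPzRingType) (y : 'I_n -> F) e (s : 'S_n) :
  alternant y (e \o s) = (-1) ^+ s * alternant y e.
Proof.
rewrite /alternant -(odd_permV s) -(det_perm F) mulrC -det_mulmx -col_permE.
by congr (\det _); apply/matrixP=> i j; rewrite !mxE.
Qed.

(** Both alternants list their exponents in decreasing order; reversing the columns
    introduces the same sign on either side and reduces to increasing order. *)
Lemma dual_jacobi_trudi (F : comNzRingType) (y : 'I_n -> F) m :
  let lam := partition_of m in
  alternant y (beta m)
  = \det (\matrix_(i < head 0%N lam, j < head 0%N lam)
            esp y ((tpart lam i)%:Z - i%:Z + j%:Z))
    * alternant y (fun j => n.-1 - j)%N.
Proof.
move=> lam; pose mu (a : 'I_n) := nth 0%N lam (rev_ord a).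
have mu_homo (a b : 'I_n) : (a <= b)%N -> (mu a <= mu b)%N.
  by move=> ab; apply: partition_of_homo; rewrite /= leq_sub2l.
have mu_le a : (mu a <= head 0%N lam)%N by rewrite -nth0; apply: partition_of_homo.
have := dual_jacobi_trudi_incr y mu_homo mu_le.
have tp b : (\sum_(a < n) (b < mu a) = tpart lam b)%N.
  by rewrite tpart_sum [RHS](reindex_inj rev_ord_inj).
have -> : \matrix_(b < head 0%N lam, b' < head 0%N lam)
     esp y ((\sum_(a < n) (b < mu a))%N%:Z - b%:Z + b'%:Z)
  = \matrix_(b, b') esp y ((tpart lam b)%:Z - b%:Z + b'%:Z).
  by apply/matrixP => b b'; rewrite !mxE tp.
rewrite -!/(alternant _ _) => /(congr1 ( *%R ((-1) ^+ rev_perm n))).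
rewrite mulrCA -!alternant_perm => incr.
transitivity (alternant y ((fun j => mu j + j)%N \o rev_perm n)).
  congr (\det _); apply/matrixP => i j; rewrite !mxE /= permE /mu rev_ordK beta_partition.
  by congr (_ ^+ (_ + _)); have := ltn_ord j; rewrite /=; lia.
rewrite incr; congr (_ * \det _); apply/matrixP => i j; rewrite !mxE /= permE.
by congr (_ ^+ _); have := ltn_ord j; rewrite /=; lia.
Qed.
End Beta.

(** * The Pieri rule *)
Section AlternantVanish.
Variables (K : fieldType) (n : nat) (y : 'I_n -> K).
Implicit Type e : 'I_n -> nat.

Lemma eq_alternant e1 e2 : e1 =1 e2 -> alternant y e1 = alternant y e2.
Proof. by move=> e12; congr (\det _); apply/matrixP => i j; rewrite !mxE e12. Qed.

Lemma alternant_shift e c :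
  alternant y (fun j => e j + c)%N = (\prod_i y i) ^+ c * alternant y e.
Proof.
rewrite /alternant -prodrXl.
transitivity (\det (diag_mx (\row_i y i ^+ c) *m \matrix_(i, j) y i ^+ e j)).
  congr (\det _); rewrite mul_diag_mx; apply/matrixP => i j.
  by rewrite !mxE exprD mulrC.
rewrite det_mulmx det_diag; congr (_ * _).
by apply: eq_bigr => i _; rewrite mxE.
Qed.

Lemma alternant_dependent e j1 j2 c : j1 != j2 ->
  (forall i, y i ^+ e j1 = c * y i ^+ e j2) -> alternant y e = 0.
Proof.
move=> j12 dep; apply/eqP; rewrite /alternant -det_tr; apply/det0P.
exists (delta_mx 0 j1 - c *: delta_mx 0 j2).
  apply/eqP => /matrixP /(_ 0 j1); rewrite !mxE !eqxx [j1 == j2](negbTE j12).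
  by rewrite mulr0 subr0 => /eqP; rewrite oner_eq0.
rewrite mulmxBl -scalemxAl -!rowE; apply/matrixP => i j; rewrite !mxE.
by rewrite dep subrr.
Qed.

(** In the Leibniz expansion the term of s for the exponents e + 1_I is the term of s for e
    times the product of the y_i with s i in I, and s permutes the r-element sets. *)
Lemma pieri e (r : nat) :
  \sum_(I : {set 'I_n} | #|I| == r) alternant y (fun j => e j + (j \in I))%N
  = esp y r * alternant y e.
Proof.
rewrite /alternant /determinant exchange_big mulr_sumr /=; apply: eq_bigr => s _.
rewrite mulr_suml (reindex_inj (imset_inj (@perm_inj _ s))) /=.
apply: eq_big => [I|I _]; first by rewrite card_imset //; apply: perm_inj.
rewrite mulrCA; congr (_ * _); rewrite [in RHS]big_mkcond -big_split /=.
apply: eq_bigr => i _; rewrite !mxE mem_imset ?exprD; last exact: perm_inj.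
by case: (i \in I); rewrite mulrC.
Qed.
End AlternantVanish.

(** * The cyclic order of the sites *)
Section CyclicOrder.
Variable n : nat.
Implicit Types p q : 'I_n.

Lemma val_ord_pred q :
  ord_pred q = (if q == 0%N :> nat then n.-1 else q.-1) :> nat.
Proof.
have q_n := ltn_ord q; rewrite /=; case: ifP => [/eqP ->|/negbT q0].
  by rewrite modn_small; lia.
rewrite (_ : (q + n).-1 = q.-1 + n)%N; last by lia.
by rewrite modnDr modn_small; lia.
Qed.

Lemma val_ordS q : ordS q = (if q == n.-1 :> nat then 0%N else q.+1) :> nat.
Proof.
have q_n := ltn_ord q; rewrite /=; case: ifP => [/eqP qn|/negbT qn].
  by rewrite (_ : q.+1 = n) ?modnn; lia.
by rewrite modn_small; lia.
Qed.

Lemma val_iter_ord_pred q t : (t <= n)%N ->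
  iter t (@ord_pred n) q = ((q + (n - t)) %% n)%N :> nat.
Proof.
elim: t => [|t IH] tn; first by rewrite subn0 modnDr modn_small.
rewrite iterS /= IH; last exact: ltnW.
have -> : ((q + (n - t)) %% n + n).-1 = ((q + (n - t)) %% n + n.-1)%N by lia.
rewrite modnDml -[RHS]modnDr; congr (_ %% _)%N; lia.
Qed.

Lemma iter_ord_pred_neq q i j : (i < j)%N -> (j < n)%N ->
  iter j (@ord_pred n) q != iter i (@ord_pred n) q.
Proof.
move=> ij jn; rewrite -val_eqE /= !val_iter_ord_pred; try lia.
have := ltn_ord q => qn; apply/eqP.
have mod_small x : (x < n + n)%N -> (x %% n = if x < n then x else x - n)%N.
  move=> xn; case: ltnP => [/modn_small //|nx].
  by rewrite -{1}(subnK nx) modnDr modn_small //; lia.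
rewrite !mod_small; try lia.
by case: (ltnP (q + (n - j))); case: (ltnP (q + (n - i))); lia.
Qed.

Lemma mem_traject_ord_pred p q :
  (q \in traject (@ord_pred n) (ord_pred p) n.-1) = (q != p).
Proof.
have n_gt0 : (0 < n)%N by case: n p => // [[]].
set s := traject _ _ _.
have s_p : rcons s p = traject (@ord_pred n) (ord_pred p) n.-1.+1.
  rewrite trajectSr; congr rcons; rewrite -iterSr prednK //.
  by apply: val_inj; rewrite /= val_iter_ord_pred // subnn addn0 modn_small.
have uniq_sp : uniq (rcons s p).
  rewrite s_p; apply/(uniqP (ord_pred p)) => i j; rewrite !inE size_traject prednK // => i_n j_n.
  rewrite !nth_traject ?prednK // => ij; apply/eqP; case: ltngtP => // lt_ij.
    by have := iter_ord_pred_neq (ord_pred p) lt_ij j_n; rewrite ij eqxx.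
  by have := iter_ord_pred_neq (ord_pred p) lt_ij i_n; rewrite ij eqxx.
have all_sp : q \in rcons s p.
  have : #|rcons s p| = #|'I_n| by rewrite (card_uniqP uniq_sp) s_p size_traject card_ord prednK.
  by move/subset_cardP => /(_ (subset_predT _)) ->.
move: all_sp uniq_sp; rewrite mem_rcons inE rcons_uniq => /orP[/eqP ->|qs].
  by rewrite eqxx => /andP[/negbTE].
by case/andP => ps _; rewrite qs; apply/esym; apply: contraNneq ps => <-.
Qed.
End CyclicOrder.

(** * Eigenfunctionals of the hopping operators *)
Section LevelExpansion.
Variables (K : fieldType) (n k : nat).
Implicit Type v : fock K n.

Lemma mcoeff_ket (m m' : state n) : (ket K m)@_m' = (m == m')%:R.
Proof. by rewrite /ket mcoeffU. Qed.

Lemma mcoeff_sum (I : Type) (r : seq I) (P : pred I) (f : I -> fock K n) m :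
  (\sum_(i <- r | P i) f i)@_m = \sum_(i <- r | P i) (f i)@_m.
Proof. exact: raddf_sum. Qed.

Lemma mcoeff_sum_ket (c : weight n k -> K) (w : weight n k) :
  (\sum_(v : weight n k) c v *: ket K v)@_(w : state n) = c w.
Proof.
rewrite mcoeff_sum (bigD1 w) //= mcoeffZ mcoeff_ket eqxx mulr1 big1 ?addr0 // => v vw.
by rewrite mcoeffZ mcoeff_ket [_ == _](negbTE vw) mulr0.
Qed.

Lemma level_expand v : v \in level_pred k ->
  v = \sum_(w : weight n k) v@_(w : state n) *: ket K w.
Proof.
move/level_predP => vk; apply/malgP => m; rewrite mcoeff_sum.
under eq_bigr do rewrite mcoeffZ mcoeff_ket.
have [v0|/vk /eqP mk] := eqVneq v@_m 0.
  rewrite v0 big1 // => w _; case: eqP => [wm|_]; rewrite ?mulr0 //.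
  by rewrite wm v0 mul0r.
rewrite (bigD1 (Weight mk)) //= eqxx mulr1 big1 ?addr0 // => w wm.
by rewrite (negbTE (_ : weight_state w != m)) ?mulr0 // -[m]/(val (Weight mk)) (inj_eq val_inj).
Qed.
End LevelExpansion.

(** The two conditions on y are those satisfied by the exponentials of a weight of level k.
    The first makes up for the full columns that are removed when a particle moves from site
    n - 1 to site 0, the second for the bound k on the number of columns. *)
Section Eigenfunctional.
Variables (K : fieldType) (n k : nat) (y : 'I_n -> K).
Hypothesis n_ge2 : (2 <= n)%N.
Hypothesis y_prod : \prod_i y i = 1.
Hypothesis y_pow : forall i j, y i ^+ (k + n) = y j ^+ (k + n).
Implicit Types (m : state n) (v : fock K n) (I : {set 'I_n}).

Definition eigenfun v : K := \sum_(w : weight n k) v@_(w : state n) * alternant y (beta w).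

Lemma eigenfun0 : eigenfun 0 = 0.
Proof. by rewrite /eigenfun big1 // => w _; rewrite mcoeff0 mul0r. Qed.

Lemma eigenfunD u v : eigenfun (u + v) = eigenfun u + eigenfun v.
Proof. by rewrite /eigenfun -big_split; apply: eq_bigr => w _ /=; rewrite mcoeffD mulrDl. Qed.

Lemma eigenfunZ a v : eigenfun (a *: v) = a * eigenfun v.
Proof. by rewrite /eigenfun mulr_sumr; apply: eq_bigr => w _; rewrite mcoeffZ mulrA. Qed.

Lemma eigenfun_sum (J : Type) (r : seq J) (P : pred J) (f : J -> fock K n) :
  eigenfun (\sum_(i <- r | P i) f i) = \sum_(i <- r | P i) eigenfun (f i).
Proof. exact: (big_morph eigenfun eigenfunD eigenfun0). Qed.

Lemma eigenfun_ket (w : weight n k) : eigenfun (ket K w) = alternant y (beta w).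
Proof.
rewrite /eigenfun (bigD1 w) //= mcoeff_ket eqxx mul1r big1 ?addr0 // => w' w'w.
by rewrite mcoeff_ket [_ == _](_ : _ = false) ?mul0r // eq_sym; apply: negbTE.
Qed.

Definition hop_state m (i : 'I_n) : state n :=
  [ffun j => m j - (j == i) + (j == ordS i)]%N.

Lemma ordS_neq (i : 'I_n) : ordS i != i.
Proof.
apply/eqP => si; have := val_ordS i; rewrite si.
by have := ltn_ord i; case: eqP; lia.
Qed.

Lemma sum_hop_state m i (P : pred 'I_n) : m i != 0%N ->
  ((\sum_(j | P j) (hop_state m i j)) + P i = (\sum_(j | P j) m j) + P (ordS i))%N.
Proof.
move=> mi.
have sum_eq a : (\sum_(j | P j) (j == a) = P a)%N.
  rewrite big_mkcond (bigD1 a) //= eqxx big1 ?addn0; first by case: (P a).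
  by move=> j /negbTE ->; case: ifP.
rewrite -[P i : nat]sum_eq -[P (ordS i) : nat]sum_eq -!big_split /=.
apply: eq_bigr => j _; rewrite ffunE.
by have [->|ji] := eqVneq j i; rewrite ?subn0; lia.
Qed.

Lemma hop_state_level m i : m i != 0%N ->
  (\sum_j hop_state m i j = \sum_j m j)%N.
Proof. by move=> /(sum_hop_state predT)/addIn. Qed.

(** A hop from i adds a box in row i + 1. When i = n - 1 this completes a column of length n,
    which is removed, so that all other beta numbers drop by one instead. *)
Lemma beta_hop m i (j : 'I_n) : m i != 0%N ->
  (beta (hop_state m i) j + (i == n.-1 :> nat) = beta m j + (j == i))%N.
Proof.
move=> mi; have := sum_hop_state (fun a : 'I_n => j < a)%N mi.
have betaE m' : beta m' j = (\sum_(a < n | (j < a)%N) m' a + (n.-1 - j))%N.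
  by rewrite beta_partition nth_partition_of.
have := ltn_ord i; have := ltn_ord j.
by rewrite !betaE val_ordS -val_eqE /=; case: eqP; lia.
Qed.

(** Removing a full column divides the alternant by the product of the y_i, which is 1. *)
Lemma alternant_hop m i I : m i != 0%N -> i \in I ->
  alternant y (fun j => beta (hop_state m i) j + (j \in I :\ i))%N
  = alternant y (fun j => beta m j + (j \in I))%N.
Proof.
move=> mi iI; rewrite -[LHS]mul1r -(expr1n _ (i == n.-1 :> nat)) -y_prod -alternant_shift.
apply: eq_alternant => j; rewrite addnAC beta_hop // -addnA !inE; congr addn.
by have [->|] := eqVneq j i; rewrite ?iI.
Qed.

Lemma beta0 m (i : 'I_n) : i = 0%N :> nat -> m i = 0%N -> (\sum_j m j = k)%N ->
  (beta m i = k + n - 1)%N.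
Proof.
move=> i0 mi mk; rewrite beta_partition nth_partition_of.
have -> : (\sum_(a < n | (i < a)%N) m a = k)%N.
  rewrite -mk [RHS](bigD1 i) //= mi add0n; apply: eq_bigl => a.
  by rewrite -val_eqE /= i0 lt0n.
lia.
Qed.

(** A blocked hop contributes 0. If i > 0 and m i = 0, the beta numbers of i - 1 and i
    differ by 1 and adding a box in row i + 1 only makes two columns equal. If i = 0 and
    m 0 = 0, the first exponent becomes k + n and the last one is 0, so the two columns are
    proportional because all y_i have the same power k + n. *)
Lemma alternant_stuck m i I : (\sum_j m j = k)%N -> m i = 0%N ->
  i \in I -> ord_pred i \notin I ->
  alternant y (fun j => beta m j + (j \in I))%N = 0.
Proof.
move=> mk mi iI piI; have i_n := ltn_ord i.
have pi_neq : i != ord_pred i by rewrite -{1}(ord_predK i) ordS_neq.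
have [i0|i0] := eqVneq (i : nat) 0%N.
  apply: (alternant_dependent pi_neq (c := y i ^+ (k + n))) => a.
  rewrite iI (negbTE piI) (beta0 i0 mi mk) (y_pow i a) /beta big_pred0.
    by rewrite mulr1; congr (_ ^+ _); lia.
  by move=> b; have := ltn_ord b; rewrite val_ord_pred i0 eqxx; lia.
apply: (alternant_dependent pi_neq (c := 1)) => a; rewrite mul1r.
congr (_ ^+ _); rewrite iI (negbTE piI) !beta_partition !nth_partition_of.
have -> : (\sum_(b < n | ord_pred i < b) m b = \sum_(b < n | i < b) m b)%N.
  have pi_i : (ord_pred i < i)%N by rewrite val_ord_pred (negbTE i0); lia.
  rewrite (bigD1 i pi_i) -[LHS]/(m i + _)%N mi add0n.
  by apply: eq_bigl => b; rewrite val_ord_pred (negbTE i0) -val_eqE /=; lia.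
by rewrite val_ord_pred (negbTE i0); lia.
Qed.

(** Starting from p outside I, the sites p + 1, p + 2, ... hop in this order, so when i hops
    its predecessor i - 1 no longer will, which is the situation of the two preceding
    lemmas. The induction is on the number of sites that remain to be treated, the next
    one being the last entry of the trajectory of the predecessor map. *)
Lemma eigenfun_cyclic_prod I m : (\sum_j m j = k)%N -> I != setT ->
  eigenfun (cyclic_prod K I (ket K m)) = alternant y (fun j => beta m j + (j \in I))%N.
Proof.
move=> mk InT; rewrite /cyclic_prod; case: pickP => [p pI|all_in]; last first.
  by case/eqP: InT; apply/setP => i; rewrite inE; have := all_in i => /negbFE.
have partial t m' : (t <= n.-1)%N -> (\sum_j m' j = k)%N ->
  let s := traject (@ord_pred n) (ord_pred p) t in
  eigenfun ((\prod_(i <- s | i \in I) hop K i) (ket K m'))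
  = alternant y (fun j => beta m' j + (j \in [set i in I | i \in s]))%N.
  elim: t m' => [|t IH] m' tn m'k s.
    rewrite big_nil endo1E -[m']/(weight_state (Weight (introT eqP m'k))) eigenfun_ket.
    by apply: eq_alternant => j; rewrite /s !inE andbF addn0.
  rewrite /s trajectSr; set q := iter t _ _; set s' := traject _ _ t.
  rewrite -cats1 big_cat /=.
  rewrite [\prod_(i <- [:: q] | _) _]big_mkcond big_seq1.
  have q_s' : q \notin s'.
    apply/trajectP => -[i it qE].
    have t_n : (t < n)%N by lia.
    exact: elimN eqP (iter_ord_pred_neq (ord_pred p) it t_n) qE.
  case: ifP => [qI|qI]; last first.
    rewrite endo1E IH //; last by lia.
    apply: eq_alternant => j; rewrite !inE mem_cat inE.
    by have [->|] := eqVneq j q; rewrite ?orbF ?qI.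
  have IE : [set i in I | i \in s'] = [set i in I | i \in s' ++ [:: q]] :\ q.
    apply/setP => i; rewrite !inE mem_cat inE.
    by have [->|] := eqVneq i q; rewrite ?orbF ?(negbTE q_s') ?andbF.
  have qJ : q \in [set i in I | i \in s' ++ [:: q]] by rewrite inE qI mem_cat inE eqxx orbT.
  rewrite hopE; case: ifP => [/eqP mq|/negbT mq].
    rewrite linear0 eigenfun0 (alternant_stuck m'k mq qJ) // inE mem_cat inE negb_and.
    apply/orP; right; rewrite negb_or andbC.
    have t_n : (t.+1 < n)%N by lia.
    rewrite (_ : ord_pred q = iter t.+1 (@ord_pred n) (ord_pred p)) //.
    rewrite [X in X && _](iter_ord_pred_neq (ord_pred p) (ltnSn t) t_n) /=.
    apply/trajectP => -[i it qE].
    exact: elimN eqP (iter_ord_pred_neq (ord_pred p) (ltnW it : (i < t.+1)%N) t_n) qE.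
  rewrite -/(hop_state m' q) IH ?hop_state_level //; last by lia.
  by rewrite IE alternant_hop.
have := partial n.-1 m (leqnn _) mk => /= ->.
apply: eq_alternant => j; rewrite inE mem_traject_ord_pred.
by have [->|] := eqVneq j p; rewrite ?andbT // (negbTE pI).
Qed.

(** Summing over I turns the previous lemma into the Pieri rule; in degrees 0 and n both the
    operator and the symmetric polynomial are 1. *)
Lemma eigenfun_elem_sym r v : v \in level_pred k ->
  eigenfun (elem_sym K n r v) = esp y r * eigenfun v.
Proof.
move=> vk; rewrite (level_expand vk) linear_sum !eigenfun_sum mulr_sumr.
apply: eq_bigr => w _; rewrite linearZ !eigenfunZ mulrCA; congr (_ * _).
case: r => r; last by rewrite [elem_sym _ _ _]/= [esp _ _]/= eigenfun0 mul0r.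
rewrite eigenfun_ket; have wk := eqP (weight_level w).
have [r0n|rn] := boolP ((r == 0%N) || (r == n)).
  have -> : esp y r = 1 by case/orP: r0n => /eqP ->; rewrite ?esp0 ?esp_full.
  by rewrite [elem_sym _ _ _]/= r0n mul1r eigenfun_ket.
rewrite -pieri [elem_sym _ _ _]/= (negbTE rn).
transitivity (eigenfun (\sum_(I : {set 'I_n} | #|I| == r) cyclic_prod K I (ket K w))).
  congr eigenfun.
  exact: (big_morph (fun f : endo (fock K n) => f (ket K w)) (fun _ _ => erefl) erefl).
rewrite eigenfun_sum; apply: eq_bigr => I Ir; rewrite eigenfun_cyclic_prod //.
by apply: contra rn => /eqP IT; rewrite -(eqP Ir) IT cardsT card_ord eqxx orbT.
Qed.

(** A relation compatible with ring operations in both arguments, so that it passes from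
    the e_r to a determinant in the e_r although the ring of operators is not
    commutative. *)
Definition eigen (f : endo (fock K n)) (c : K) :=
  preserves k f /\ forall v, v \in level_pred k -> eigenfun (f v) = c * eigenfun v.

Lemma eigen0 : eigen 0 0.
Proof. by split=> [|v _]; [apply: preserves0|rewrite endo0E eigenfun0 mul0r]. Qed.

Lemma eigen1 : eigen 1 1.
Proof. by split=> [|v _]; [apply: preserves1|rewrite endo1E mul1r]. Qed.

Lemma eigenD f g c d : eigen f c -> eigen g d -> eigen (f + g) (c + d).
Proof.
move=> [fk fc] [gk gd]; split=> [|v vk]; first exact: preservesD.
by rewrite endoDE eigenfunD mulrDl fc ?gd.
Qed.

Lemma eigenM f g c d : eigen f c -> eigen g d -> eigen (f * g) (c * d).
Proof.
move=> [fk fc] [gk gd]; split=> [|v vk]; first exact: preservesM.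
by rewrite endoME fc ?gd ?mulrA //; apply: gk.
Qed.

Lemma eigenN1 : eigen (-1) (-1).
Proof.
split=> [|v _]; first exact/preservesN/preserves1.
by rewrite endoNE endo1E -scaleN1r eigenfunZ.
Qed.

Lemma eigen_elem_sym r : eigen (elem_sym K n r) (esp y r).
Proof. by split=> [|v]; [apply: elem_preserves|apply: eigenfun_elem_sym]. Qed.

Lemma eigen_schur lam : eigen (schur K n lam)
  (\det (\matrix_(i < head 0%N lam, j < head 0%N lam)
           esp y ((tpart lam i)%:Z - i%:Z + j%:Z))).
Proof.
apply: (big_ind2 eigen) => [|f c g d fc gd|s _]; [exact: eigen0| |].
  exact: (eigenD fc gd).
apply: eigenM; first by case: (odd_perm s); rewrite ?expr1 ?expr0;
  [apply: eigenN1|apply: eigen1].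
apply: (big_ind2 eigen) => [|f c g d fc gd|i _]; [exact: eigen1| |].
  exact: (eigenM fc gd).
by rewrite !mxE; apply: eigen_elem_sym.
Qed.

(** The eigenvalue of s_lambda(a) is s_lambda(y), a quotient of alternants; the statement is
    free of denominators. *)
Lemma eigenfun_schur (w : weight n k) v : v \in level_pred k ->
  alternant y (fun j => n.-1 - j)%N * eigenfun (schur K n (partition_of w) v)
  = alternant y (beta w) * eigenfun v.
Proof.
move=> vk; have [_ ->//] := eigen_schur (partition_of w).
by rewrite mulrA [_ * \det _]mulrC -dual_jacobi_trudi.
Qed.
End Eigenfunctional.

(** * Roots of unity *)
Section Cis.
Variable R : realType.
Implicit Types t u : R.

Lemma cis0 : cis 0 = 1 :> R[i].
Proof. by rewrite /cis cos0 sin0. Qed.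

Lemma cisD t u : cis (t + u) = cis t * cis u.
Proof. by rewrite /cis cosD sinD [X in (_ +i* X)%C]addrC. Qed.

Lemma cisN_conj t : cis (- t) = conjc (cis t).
Proof. by rewrite /cis cosN sinN. Qed.

Lemma cisMconj t : cis t * conjc (cis t) = 1.
Proof. by rewrite -cisN_conj -cisD subrr cis0. Qed.

Lemma cis_neq0 t : cis t != 0.
Proof.
apply/eqP => t0; have := cisMconj t; rewrite t0 mul0r => /esym/eqP.
by rewrite oner_eq0.
Qed.

Lemma cisN t : cis (- t) = (cis t)^-1.
Proof.
by apply: (mulfI (cis_neq0 t)); rewrite -cisD subrr cis0 mulfV ?cis_neq0.
Qed.

Lemma cisMn t m : cis (t * m%:R) = cis t ^+ m.
Proof.
elim: m => [|m IH]; first by rewrite mulr0 cis0.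
by rewrite exprS -IH -cisD mulrSr mulrDr mulr1 addrC.
Qed.

Lemma cis_2pi : cis (2 * pi) = 1 :> R[i].
Proof. by rewrite mulr2n mulrDl mul1r -mulr2n /cis cos2pi sin2pi. Qed.

Lemma cis_pi : cis pi = -1 :> R[i].
Proof. by rewrite /cis cospi sinpi; apply/eqP; rewrite eq_complex /= oppr0 !eqxx. Qed.

(** cos t = 1 - 2 sin(t/2)^2, and sin(t/2) is positive for 0 < t < 2 pi. *)
Lemma cis_eq1 t : 0 <= t < 2 * pi -> cis t = 1 -> t = 0.
Proof.
case/andP=> t0 t2 /eqP; rewrite eq_complex /= => /andP[/eqP ct _].
apply/eqP; rewrite eq_le t0 andbT leNgt; apply/negP => t_gt0.
have sin_gt0 : 0 < sin (t / 2) by apply: sin_gt0_pi; apply/andP; split; lra.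
have := cos_mulr2n (t / 2); rewrite cos2sin2 -[t / 2 *+ 2]mulr_natr mulfVK ?pnatr_eq0 // ct.
by have := exprn_gt0 2 sin_gt0; lra.
Qed.
End Cis.

Section RootOfUnity.
Variables (R : realType) (M : nat).
Hypothesis M_gt0 : (0 < M)%N.

Definition zeta (z : int) : R[i] := cis (2 * pi / M%:R * z%:~R).

Lemma zetaD y z : zeta (y + z) = zeta y * zeta z.
Proof. by rewrite /zeta rmorphD mulrDr cisD. Qed.

Lemma zeta0 : zeta 0 = 1.
Proof. by rewrite /zeta mulr0 cis0. Qed.

Lemma zetaN z : zeta (- z) = (zeta z)^-1.
Proof. by rewrite /zeta rmorphN mulrN cisN. Qed.

Lemma conj_zeta z : conjc (zeta z) = zeta (- z).
Proof. by rewrite /zeta rmorphN mulrN cisN_conj. Qed.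

Lemma zeta_neq0 z : zeta z != 0.
Proof. exact: cis_neq0. Qed.

Lemma zetaMn z (m : nat) : zeta (z * m%:Z) = zeta z ^+ m.
Proof. by rewrite /zeta rmorphM mulrA cisMn. Qed.

Lemma zeta_sum (I : Type) (r : seq I) (P : pred I) (f : I -> int) :
  zeta (\sum_(i <- r | P i) f i) = \prod_(i <- r | P i) zeta (f i).
Proof. exact: (big_morph zeta zetaD zeta0). Qed.

Lemma zeta_eq1 z : (zeta z == 1) = (M%:Z %| z)%Z.
Proof.
have M0 : (M%:R : R) != 0 by rewrite pnatr_eq0 -lt0n.
have zetaM1 : zeta M = 1 by rewrite /zeta mulfVK // cis_2pi.
have zetaMz a : zeta (a * M%:Z) = 1.
  by case: a => m; rewrite ?NegzE ?mulNr ?zetaN mulrC zetaMn zetaM1 expr1n ?invr1.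
apply/eqP/dvdzP => [z1|[q ->]] //.
exists (z %/ M)%Z; rewrite {1}(divz_eq z M).
suff -> : (z %% M)%Z = 0 by rewrite addr0.
move: z1; rewrite {1}(divz_eq z M) zetaD zetaMz mul1r.
have Mz0 : M%:Z != 0 by rewrite eqz_nat -lt0n.
have := modz_ge0 z Mz0; have := @ltz_pmod z M M_gt0.
case: (z %% M)%Z => [r|r] // rM _ /cis_eq1 r0.
have Mp : 0 < (M%:R : R) by rewrite ltr0n.
have pi2 : 0 < 2 * pi :> R by rewrite mulr_gt0 ?pi_gt0.
have : 2 * pi / M%:R * r%:~R = 0 :> R.
  apply: r0; apply/andP; split; first by rewrite !mulr_ge0 ?invr_ge0 ?ler0n ?pi_ge0 ?ler0z.
  by rewrite mulrAC ltr_pdivrMr // ltr_pM2l // ltr_nat.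
move/eqP; rewrite mulf_eq0 mulf_eq0 (gt_eqF pi2) invr_eq0 (negbTE M0) /=.
by rewrite pnatr_eq0 => /eqP ->.
Qed.

(** The values form a geometric progression with ratio zeta (n' d), an N'-th root of unity
    equal to 1 exactly when N' divides d. *)
Lemma sum_zeta (N' n' : nat) (d : int) : (0 < N')%N -> M = (n' * N')%N ->
  \sum_(j < N') zeta (n'%:Z * j%:Z * d) = if (N'%:Z %| d)%Z then N'%:R else 0.
Proof.
move=> N_gt0 ME.
have dvdE : (zeta (n'%:Z * d) == 1) = (N'%:Z %| d)%Z.
  rewrite zeta_eq1 ME PoszM dvdz_mul2l //.
  by case: n' ME M_gt0 => [->|].
under eq_bigr do rewrite mulrAC zetaMn.
case: ifP => d1.
  move: dvdE; rewrite d1 => /eqP ->; under eq_bigr do rewrite expr1n.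
  by rewrite sumr_const card_ord.
have q1 : zeta (n'%:Z * d) - 1 != 0 by rewrite subr_eq0 dvdE d1.
apply: (mulfI q1); rewrite mulr0 -subrX1 -zetaMn mulrAC.
have : (M%:Z %| n'%:Z * N'%:Z * d)%Z by rewrite ME PoszM dvdz_mulr.
by rewrite -zeta_eq1 => /eqP ->; rewrite subrr.
Qed.
End RootOfUnity.

(** * Weights as strictly decreasing sequences *)
Section BetaCombinatorics.
Variables n k : nat.
Hypothesis n_gt0 : (0 < n)%N.
Implicit Types (w : weight n k) (i j : 'I_n).

Definition last_ord : 'I_n := Ordinal (etrans (ltn_predL n) n_gt0).

Lemma beta_last m : @beta n m last_ord = 0%N.
Proof. by rewrite /beta big_pred0 // => i /=; have := ltn_ord i; lia. Qed.

Lemma beta_cons (m : state n) (P : pred 'I_n) (j : 'I_n) :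
  (forall i, P i = (j <= i)%N) -> (\sum_(i | P i) (m i).+1 = (m j).+1 + beta m j)%N.
Proof.
move=> PE; rewrite (bigD1 j) ?PE //=; congr addn; apply: eq_bigl => i.
by rewrite PE -val_eqE /=; lia.
Qed.

Lemma beta_pred (m : state n) j : (0 < j)%N -> (beta m j.-1 = (m j).+1 + beta m j)%N.
Proof. by move=> j0; apply: beta_cons => i; lia. Qed.

Lemma beta_zero w j : j = 0%N :> nat -> ((w j).+1 + beta w j = k + n)%N.
Proof.
move=> j0; rewrite -(@beta_cons w predT) => [|i]; last by rewrite j0.
under eq_bigr do rewrite -addn1.
by rewrite big_split /= (eqP (weight_level w)) sum1_card card_ord.
Qed.

Lemma beta_ltn w i j : (i < j)%N -> (beta w j < beta w i)%N.
Proof.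
move=> ij; have j0 : (0 < j)%N by lia.
apply: (@leq_trans (beta w j.-1)); first by rewrite beta_pred // addSn ltnS leq_addl.
rewrite /beta big_mkcond [leqRHS]big_mkcond; apply: leq_sum => a _ /=.
by case: ifP => // ja; rewrite ifT //; lia.
Qed.

Lemma ltn_beta w i j : (beta w j < beta w i)%N = (i < j)%N.
Proof.
case: (ltngtP i j) => [/(beta_ltn w)->|/(beta_ltn w) ji|/val_inj->] //.
  by rewrite ltnNge (ltnW ji).
by rewrite ltnn.
Qed.

Lemma beta_lt w j : (beta w j < k + n)%N.
Proof.
have [j0|j0] := posnP j; first by rewrite -(beta_zero w j0) addSn ltnS leq_addl.
have := beta_zero w (erefl : (Ordinal n_gt0 : nat) = 0%N).
by have := @beta_ltn w (Ordinal n_gt0) j j0; rewrite /=; lia.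
Qed.

Lemma beta_inj w w' : (forall j, beta w j = beta w' j) -> w = w'.
Proof.
move=> ww'; apply/val_inj/ffunP => j /=.
have [j0|j0] := posnP j.
  by have := beta_zero w j0; have := beta_zero w' j0; have := ww' j; lia.
have jn : (j.-1 < n)%N by have := ltn_ord j; lia.
have := beta_pred w j0; have := beta_pred w' j0.
by have := ww' j; have := ww' (Ordinal jn); rewrite /=; lia.
Qed.

(** A strictly decreasing sequence and a permutation are both determined by the permuted
    sequence: the number of larger entries gives the position of an entry. *)
Lemma beta_rank w (s : 'S_n) i :
  #|[set j | (beta w (s i) < beta w (s j))%N]| = s i :> nat.
Proof.
transitivity #|s @^-1: [set j : 'I_n | (j < s i)%N]|.
  by apply: eq_card => j; rewrite !inE ltn_beta.
rewrite card_preimset; last exact: perm_inj.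
rewrite cardsE -sum1_card (big_ord_narrow (ltnW (ltn_ord (s i)))).
by rewrite sum1_card card_ord.
Qed.

Lemma beta_perm_inj w w' (s s' : 'S_n) :
  (forall i, beta w (s i) = beta w' (s' i)) -> w = w' /\ s = s'.
Proof.
move=> ww'; have ss' : s = s'.
  apply/permP => i; apply: val_inj => /=; rewrite -(beta_rank w s i) -(beta_rank w' s' i).
  by apply: eq_card => j; rewrite !inE !ww'.
split=> //; apply: beta_inj => j; rewrite -[j](permKV s) ww' -ss'.
by [].
Qed.

Fact rotate_level w : (\sum_i [ffun i => w (ord_pred i)] i)%N == k.
Proof.
rewrite -[k in _ == k](eqP (weight_level w)) (reindex_inj (@ordS_inj n)) /=.
by apply/eqP/eq_bigr => i _; rewrite ffunE ordSK.
Qed.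
Definition rotate w : weight n k := Weight (rotate_level w).

Lemma rotate_inj : injective rotate.
Proof.
move=> w w' /(congr1 val)/ffunP ww'; apply/val_inj/ffunP => i /=.
by have := ww' (ordS i); rewrite !ffunE ordSK.
Qed.

(** Up to a common translation, rotating a weight rotates its beta numbers cyclically and
    adds the period k + n to the one that moves from the end to the front. *)
Lemma beta_rotate w j :
  (beta (rotate w) j + (w last_ord).+1
   = beta w (ord_pred j) + (if j == 0%N :> nat then k + n else 0))%N.
Proof.
have -> : (beta (rotate w) j + (w last_ord).+1 = \sum_(i < n | (j <= i)%N) (w i).+1)%N.
  rewrite [RHS](bigD1 last_ord) /=; last by have := ltn_ord j; lia.
  rewrite addnC; congr addn; rewrite /beta (reindex_inj (@ordS_inj n)).
  apply: eq_big => [i|i _]; last by rewrite ffunE ordSK.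
  rewrite val_ordS -val_eqE /=.
  by have := ltn_ord i; case: eqP; lia.
rewrite (@beta_cons w _ j) // val_ord_pred; have [j0|j0] := eqVneq (j : nat) 0%N.
  by rewrite beta_zero // -[n.-1]/(nat_of_ord last_ord) beta_last.
by rewrite -beta_pred ?lt0n // addn0.
Qed.

Definition tuple_of (p : weight n k * 'S_n) : {ffun 'I_n -> 'I_(k + n)} :=
  [ffun i => Ordinal (beta_lt p.1 (p.2 i))].

Lemma tuple_of_inj : injective tuple_of.
Proof.
move=> [w s] [w' s'] /ffunP E; have [i|-> -> //] := @beta_perm_inj w w' s s'.
by have := congr1 val (E i); rewrite !ffunE.
Qed.

Lemma telescope_ltn (f : nat -> nat) (q j : nat) :
  (forall i : nat, (i < q)%N -> (f i.+1 < f i)%N) ->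
  (j <= q)%N -> (\sum_(i < q | (j <= i)%N) (f i - f i.+1) + f q = f j)%N.
Proof.
elim: q => [|q IH] f_decr.
  by rewrite leqn0 => /eqP ->; rewrite big_ord0.
rewrite leq_eqVlt big_mkcond big_ord_recr /= -big_mkcond => /orP[/eqP ->|].
  by rewrite big1 ?ltnn // => i; have := ltn_ord i; lia.
rewrite ltnS => jq; rewrite jq -addnA subnK; last exact: ltnW (f_decr q (ltnSn q)).
by apply: IH => // i iq; apply: f_decr; apply: ltnW.
Qed.

(** The position of x i in decreasing order is the number of larger entries; sorting x gives
    the beta numbers z, and the occupation numbers are the gaps of the sequence
    k + n, z 0, z 1, ..., z (n-1) minus 1. Containing 0 makes this sequence end in 0, and then
    the gaps add up to k + n. *)
Lemma tuple_of_onto (x : {ffun 'I_n -> 'I_(k + n)}) i0 :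
  injective x -> x i0 = 0%N :> nat -> exists p, x = tuple_of p.
Proof.
move=> x_inj x0; have x_lt_inj i j : i != j -> (x i < x j)%N || (x j < x i)%N.
  by rewrite -neq_ltn (inj_eq val_inj) (inj_eq x_inj).
pose above i := [set j | (x i < x j)%N].
have above_lt i : (#|above i| < n)%N.
  rewrite -[n in leqRHS]card_ord -[leqRHS]cardsT; apply: proper_card.
  by rewrite properEneq subsetT andbT; apply/eqP => /setP /(_ i); rewrite !inE ltnn.
pose r i := Ordinal (above_lt i).
have r_decr i j : (x i < x j)%N -> (r j < r i)%N.
  move=> ij; apply: proper_card; apply/properP; split.
    by apply/subsetP => a; rewrite !inE; apply: ltn_trans.
  by exists j; rewrite !inE ?ltnn.
have r_inj : injective r.
  move=> i j rij; apply/eqP; apply: contraT => /x_lt_inj /orP[] /r_decr.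
    by rewrite rij ltnn.
  by rewrite rij ltnn.
pose s := perm r_inj; pose z j := x ((s^-1)%g j) : nat.
have zs i : z (s i) = x i by rewrite /z permK.
have z_decr i j : (i < j)%N -> (z j < z i)%N.
  have [a ->] : exists a, i = s a by exists ((s^-1)%g i); rewrite permKV.
  have [b ->] : exists b, j = s b by exists ((s^-1)%g j); rewrite permKV.
  rewrite !zs !permE => ab; have : a != b by apply: contraTneq ab => ->; rewrite ltnn.
  by case/x_lt_inj/orP => // /r_decr; rewrite ltnNge (ltnW ab).
(* The index is shifted by one to make room for the leading entry k + n. *)
pose zz (j : nat) := if j is j'.+1 then if insub j' is Some o then z o else 0%N else (k + n)%N.
have zzS (j : 'I_n) : zz j.+1 = z j by rewrite /zz /= valK.
have zz_decr (i : nat) : (i < n)%N -> (zz i.+1 < zz i)%N.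
  move=> i_n; rewrite (zzS (Ordinal i_n)); case: i i_n => [|i] i_n /=; first exact: ltn_ord.
  by rewrite (insubT (fun a => a < n)%N (ltnW i_n)); apply: z_decr.
have zz_n : zz n = 0%N.
  have -> : n = (last_ord : nat).+1 by rewrite /=; lia.
  rewrite zzS; apply/eqP; rewrite -leqn0 -x0 -zs.
  have [->//|s_last] := eqVneq (s i0) last_ord.
  apply/ltnW/z_decr; move: s_last; rewrite -val_eqE /=.
  by have := ltn_ord (s i0); lia.
pose m : state n := [ffun i : 'I_n => (zz i - zz i.+1).-1].
have mS (i : 'I_n) : (m i).+1 = (zz i - zz i.+1)%N.
  by rewrite ffunE prednK // subn_gt0 zz_decr.
have m_level : (\sum_i m i)%N == k.
  have : (\sum_i (m i).+1 = k + n)%N.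
    under eq_bigr do rewrite mS.
    by rewrite -[RHS]/(zz 0) -(telescope_ltn zz_decr (leq0n n)) zz_n addn0.
  under eq_bigr do rewrite -addn1.
  by rewrite big_split /= sum1_card card_ord => /addIn ->.
exists (Weight m_level, s); apply/ffunP => i; rewrite ffunE; apply: val_inj => /=.
rewrite -zs -zzS -(telescope_ltn zz_decr (ltn_ord (s i))) zz_n addn0.
by apply: eq_bigr => j _; rewrite mS.
Qed.
End BetaCombinatorics.

(** * Orthogonality *)
Lemma sum_permuted n (s : 'S_n) (f : 'I_n -> nat) : (\sum_i f (s i) = \sum_i f i)%N.
Proof. by rewrite [RHS](reindex_inj (@perm_inj _ s)). Qed.

Section Orthogonality.
Variables (R : realType) (n k : nat).
Hypothesis n_gt0 : (0 < n)%N.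
Let N := (k + n)%N.
Let M := (n * N)%N.
Implicit Types (x e : 'I_n -> nat) (u v w : weight n k).

Let N_gt0 : (0 < N)%N. Proof. by rewrite /N; lia. Qed.
Let M_gt0 : (0 < M)%N. Proof. by rewrite muln_gt0 n_gt0. Qed.

(** If x lists the beta numbers of s, then x i - |x| / n is the i-th coordinate of s + rho,
    and node x i is exp (- 2 pi sqrt(-1) (s + rho)_i / N). Multiplying the exponent by n keeps
    it integral. Other sequences x are allowed in order to enlarge the sum over weights to a sum
    over a box. *)
Definition node x (i : 'I_n) : R[i] := zeta R M ((\sum_j x j)%N%:Z - n%:Z * (x i)%:Z).
Definition slater x e : R[i] := alternant (node x) e.
Definition char_val (s m : state n) : R[i] :=
  slater (fun i : 'I_n => beta s i) (fun j : 'I_n => beta m j).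

Lemma prod_node x : \prod_i node x i = 1.
Proof.
rewrite -zeta_sum sumrB sumr_const card_ord -mulr_sumr -(rmorph_sum (Posz)) /=.
by rewrite -[_ *+ n]mulr_natl natz subrr zeta0.
Qed.

Lemma node_exp x i : node x i ^+ N = zeta R M ((\sum_j x j)%N%:Z * N%:Z).
Proof.
rewrite /node -zetaMn mulrBl zetaD [X in _ * X](_ : _ = 1) ?mulr1 //.
apply/eqP; rewrite zeta_eq1 // -mulNr; apply/dvdzP; exists (- (x i)%:Z).
by rewrite /M; lia.
Qed.

Lemma conj_node x i : conjc (node x i) = (node x i)^-1.
Proof. by rewrite conj_zeta zetaN. Qed.

Lemma conj_nodeX x i m : conjc (node x i ^+ m) = (node x i)^-1 ^+ m.
Proof. by rewrite -conj_node; apply: rmorphXn. Qed.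

Lemma slater_not_injective x e i j : i != j -> x i = x j -> slater x e = 0.
Proof.
move=> ij xij; apply: (determinant_alternate ij) => a.
by rewrite !mxE /node xij.
Qed.

Lemma slater_perm x e (s : 'S_n) : slater (x \o s) e = (-1) ^+ s * slater x e.
Proof.
rewrite /slater /alternant -(det_perm (R[i])) -det_mulmx -row_permE; congr (\det _).
apply/matrixP => i j; rewrite !mxE /node /=; congr (zeta _ _ (_%:Z - _) ^+ _).
by rewrite [RHS](reindex_inj (@perm_inj _ s)).
Qed.

Lemma slater_shift x e c : slater (fun j => x j + c)%N e = slater x e.
Proof.
congr (\det _); apply/matrixP => i j; rewrite !mxE /node; congr (zeta _ _ _ ^+ _).
by rewrite big_split /= sum_nat_const card_ord; lia.
Qed.

(** Adding N to one coordinate multiplies every node by zeta N: the extra factor for that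
    coordinate is zeta (- n N) = 1. *)
Lemma slater_wrap x e i0 :
  slater (fun j => x j + (if j == i0 then N else 0))%N e
  = zeta R M (N%:Z * (\sum_j e j)%N%:Z) * slater x e.
Proof.
rewrite zetaMn /slater /alternant.
transitivity (\det (\matrix_(i, j) (node x i ^+ e j) *m diag_mx (\row_j zeta R M N ^+ e j))).
  congr (\det _); rewrite mul_mx_diag; apply/matrixP => i j; rewrite !mxE -exprMn.
  rewrite /node -zetaD; congr (_ ^+ _).
  have -> : (\sum_(j < n) (x j + (if j == i0 then N else 0)) = \sum_j x j + N)%N.
    by rewrite big_split /= -big_mkcond big_pred1_eq.
  move: (\sum_j x j)%N => S; case: eqP => _; last by congr zeta; lia.
  rewrite (_ : _ - _ = S%:Z - n%:Z * (x i)%:Z + N%:Z - M%:Z).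
    rewrite [LHS]zetaD [X in _ * X](_ : _ = 1) ?mulr1 //.
    by apply/eqP; rewrite zeta_eq1 //; apply/dvdzP; exists (-1); lia.
  by rewrite /M; lia.
rewrite det_mulmx det_diag mulrC; congr (_ * _).
by under eq_bigr do rewrite mxE; rewrite prodrXr.
Qed.

Lemma slater_norm_expand x e e' :
  slater x e * conjc (slater x e')
  = \sum_(s : 'S_n) \sum_(s' : 'S_n) (-1) ^+ s * (-1) ^+ s' *
      \prod_i zeta R M (((\sum_j x j)%N%:Z - n%:Z * (x i)%:Z)
                        * ((e (s i))%:Z - (e' (s' i))%:Z)).
Proof.
rewrite /slater /alternant -det_map_mx /determinant mulr_suml.
apply: eq_bigr => s _; rewrite mulr_sumr; apply: eq_bigr => s' _.
rewrite mulrACA -big_split; congr (_ * _); apply: eq_bigr => i _.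
rewrite !mxE; transitivity (node x i ^+ e (s i) * (node x i)^-1 ^+ e' (s' i)).
  by rewrite -conj_nodeX.
by rewrite /node -zetaN -!zetaMn -zetaD; congr zeta; lia.
Qed.

Lemma sum_window_shift u v (s s' : 'S_n) (t : int) :
  n%:Z * t = (\sum_j beta u (j : 'I_n))%N%:Z - (\sum_j beta v (j : 'I_n))%N%:Z ->
  \sum_i (t - (beta u (s i))%:Z + (beta v (s' i))%:Z) = 0.
Proof.
move=> nt; rewrite big_split sumrB /= sumr_const card_ord -!(rmorph_sum Posz) /=.
rewrite (sum_permuted s (fun j => beta u j)) (sum_permuted s' (fun j => beta v j)).
by rewrite -mulr_natl natz nt; lia.
Qed.

(** The sequences beta u and beta v have values in 0, ..., N-1, so that the multiples of N under
    consideration are all greater than - N if 0 <= t, and all less than N otherwise. They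
    have the same sign and add up to 0, hence vanish. Comparing the positions of the
    entries 0 gives t = 0. *)
Lemma window_unique u v (s s' : 'S_n) (t : int) :
  n%:Z * t = (\sum_j beta u (j : 'I_n))%N%:Z - (\sum_j beta v (j : 'I_n))%N%:Z ->
  (forall i, (N%:Z %| t - (beta u (s i))%:Z + (beta v (s' i))%:Z)%Z) ->
  u = v /\ s = s'.
Proof.
move=> nt dvd; pose d i := t - (beta u (s i))%:Z + (beta v (s' i))%:Z.
have sum_d : \sum_i d i = 0 by apply: sum_window_shift.
have bounds i : (beta u (s i) < N)%N /\ (beta v (s' i) < N)%N.
  by split; apply: beta_lt.
have d0 i : d i = 0.
  have [t_ge0|t_le0] := leP 0 t.
    apply: (@psumr_eq0P _ _ predT d) => // a _; case/dvdzP: (dvd a) (bounds a) => q.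
    rewrite -/(d a) => dq [? _]; have : - N%:Z < d a by rewrite /d; lia.
    rewrite dq -mulN1r ltr_pM2r ?ltz_nat // => q_gt.
    by rewrite mulr_ge0 //; lia.
  apply: oppr_inj; rewrite oppr0; apply: (@psumr_eq0P _ _ predT (fun a => - d a)) => //.
    move=> a _; case/dvdzP: (dvd a) (bounds a) => q.
    rewrite -/(d a) => dq [_ ?]; have : d a < N%:Z by rewrite /d; lia.
    rewrite dq -[X in _ < X]mul1r ltr_pM2r ?ltz_nat // => q_lt.
    by rewrite -mulNr mulr_ge0 //; lia.
  by rewrite sumrN sum_d oppr0.
have t0 : t = 0.
  have := d0 ((s^-1)%g (last_ord n_gt0)); have := d0 ((s'^-1)%g (last_ord n_gt0)).
  by rewrite /d !permKV !beta_last; lia.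
by apply: (beta_perm_inj n_gt0) => i; have := d0 i; rewrite /d t0; lia.
Qed.

(** The sum factors over the coordinates; the coordinate i0, fixed to be 0, contributes 1. *)
Lemma sum_rooted_characters (d : 'I_n -> int) i0 :
  \sum_(x : {ffun 'I_n -> 'I_N} | x i0 == 0%N :> nat)
     \prod_i zeta R M (n%:Z * (x i)%:Z * d i)
  = \prod_(i | i != i0) (if (N%:Z %| d i)%Z then N%:R else 0).
Proof.
pose Q (i : 'I_n) (j : 'I_N) := (i == i0) ==> (j == 0%N :> nat).
transitivity (\prod_i \sum_(j | Q i j) zeta R M (n%:Z * j%:Z * d i)).
  rewrite bigA_distr_big_dep; apply: eq_bigl => x; apply/eqP/familyP => [x0 i|].
    by rewrite unfold_in; apply/implyP => /eqP ->; apply/eqP.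
  by move/(_ i0); rewrite unfold_in /Q eqxx => /eqP.
rewrite (bigD1 i0) //= [X in X * _](_ : _ = 1) ?mul1r.
  apply: eq_bigr => i ii0; rewrite -(@sum_zeta R M M_gt0 N n (d i)) //.
  by apply: eq_bigl => j; rewrite /Q (negbTE ii0).
rewrite (big_pred1 (Ordinal N_gt0)) => [|j]; first by rewrite mulr0 mul0r zeta0.
by rewrite /Q eqxx /= -val_eqE.
Qed.

(** Expanding both determinants leaves, for each pair of permutations, a sum of characters
    that vanishes unless N divides every exponent d i with i <> i0. The d i add up to 0, so N
    then divides d i0 too, and [window_unique] leaves only u = v and s = s'. *)
Lemma sum_rooted_slater u v (t : int) i0 :
  n%:Z * t = (\sum_j beta u (j : 'I_n))%N%:Z - (\sum_j beta v (j : 'I_n))%N%:Z ->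
  \sum_(x : {ffun 'I_n -> 'I_N} | x i0 == 0%N :> nat)
     slater (fun i => x i) (fun j => beta u j) * conjc (slater (fun i => x i) (fun j => beta v j))
  = (n`! * N ^ n.-1)%:R *+ (u == v).
Proof.
move=> nt; under eq_bigr do rewrite slater_norm_expand.
rewrite exchange_big /=.
pose d (s s' : 'S_n) (i : 'I_n) := t - (beta u (s i))%:Z + (beta v (s' i))%:Z.
pose c (s s' : 'S_n) : R[i] :=
  \prod_(i | i != i0) (if (N%:Z %| d s s' i)%Z then N%:R else 0).
have sumZ (f : 'I_n -> nat) : \sum_i (f i)%:Z = (\sum_i f i)%N%:Z.
  by rewrite -(rmorph_sum Posz).
transitivity (\sum_(s : 'S_n) \sum_(s' : 'S_n) (-1) ^+ s * (-1) ^+ s' * c s s').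
  apply: eq_bigr => s _; rewrite exchange_big /=; apply: eq_bigr => s' _.
  rewrite -mulr_sumr /c -(sum_rooted_characters (d s s')); congr (_ * _); apply: eq_bigr => x _.
  rewrite -!zeta_sum; congr zeta.
  set S := (\sum_j x j)%N; pose ab i := (beta u (s i))%:Z - (beta v (s' i))%:Z.
  rewrite [LHS](eq_bigr (fun i => S%:Z * ab i - n%:Z * (x i)%:Z * ab i)) => [|i _]; last first.
    by rewrite mulrBl.
  rewrite sumrB -mulr_sumr /ab sumrB !sumZ.
  rewrite (sum_permuted s (fun j => beta u j)) (sum_permuted s' (fun j => beta v j)) -nt.
  rewrite mulrA -sumZ !mulr_suml -sumrB.
  by apply: eq_bigr => i _; rewrite /d; lia.
have cE s s' : c s s' = (N ^ n.-1)%:R *+ ((u == v) && (s == s')).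
  have [[uv ss']|uv_ss'] := altP (@andP (u == v) (s == s')).
    rewrite /c (eq_bigr (fun _ => N%:R)) => [|i _].
      rewrite prodr_const natrX; congr (_ ^+ _).
      by rewrite cardC1 card_ord.
    move: nt; rewrite /d (eqP uv) (eqP ss') subrr => /eqP.
    rewrite mulf_eq0 eqz_nat (gtn_eqF n_gt0) /= => /eqP ->.
    by rewrite sub0r addNr dvdz0.
  have [/forallP dvd|] := boolP [forall (i | i != i0), (N%:Z %| d s s' i)%Z].
    have [|uv ss'] := @window_unique u v s s' t nt; last by rewrite uv ss' !eqxx in uv_ss'.
    move=> i; rewrite -/(d s s' i); have [->|ii0] := eqVneq i i0; last first.
      by have := dvd i; rewrite ii0.
    have := sum_window_shift s s' nt; rewrite (bigD1 i0) //= => /eqP.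
    rewrite addr_eq0 -/(d s s' i0) => /eqP ->.
    by rewrite rpredN; apply: rpred_sum => j ji0; have := dvd j; rewrite ji0.
  rewrite negb_forall; case/existsP => i; rewrite negb_imply; case/andP => ii0 ndvd.
  by rewrite /c (bigD1 i) //= (negbTE ndvd) mul0r.
transitivity (\sum_(s : 'S_n) (N ^ n.-1)%:R *+ (u == v) : R[i]).
  apply: eq_bigr => s _; rewrite (bigD1 s) //= big1 ?addr0 => [|s' s's].
    by rewrite cE eqxx andbT -signr_addb addbb mul1r.
  by rewrite cE [s == s'](_ : _ = false) ?andbF ?mulr0 // eq_sym; apply: negbTE.
by rewrite sumr_const card_Sn mulrnAC -[_ *+ n`!]mulr_natl -natrM.
Qed.

(** Permuting the beta numbers of weights gives exactly the injective sequences in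
    0, ..., N-1 that contain 0, and these are the sequences counted on the right, each for
    the unique place i0 of its entry 0. *)
Lemma sum_slater_rooted (f : ('I_n -> nat) -> R[i]) :
  (forall x i j, i != j -> x i = x j -> f x = 0) ->
  \sum_(p : weight n k * 'S_n) f (fun i => beta p.1 (p.2 i))
  = \sum_i0 \sum_(x : {ffun 'I_n -> 'I_N} | x i0 == 0%N :> nat) f (fun i => x i).
Proof.
move=> f_ninj; rewrite (exchange_big_dep predT) //=.
pose T := tuple_of n_gt0 (k := k); pose im := [set T p | p : weight n k * 'S_n].
rewrite [RHS](bigID (mem im)) /= [X in _ + X]big1 ?addr0 => [|x x_im]; last first.
  rewrite big1 // => i0 /eqP x0; have [/injectiveP x_inj|] := boolP (injectiveb x).
    have [p xE] := tuple_of_onto n_gt0 x_inj x0.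
    by case/negP: x_im; apply/imsetP; exists p.
  case/injectivePn => i [j ij xij]; apply: (f_ninj _ i j ij).
  by rewrite xij.
rewrite big_imset /=; last by move=> p q _ _; apply: tuple_of_inj.
apply: eq_bigr => p _.
have TE i : T p i = beta p.1 (p.2 i) :> nat by rewrite /T ffunE.
rewrite (big_pred1 ((p.2^-1)%g (last_ord n_gt0))) => [|i /=].
  by congr f; apply: funext => i.
rewrite TE -(inj_eq (@perm_inj _ p.2)) permKV.
apply/eqP/eqP => [|->]; last exact: beta_last.
have [//|] := eqVneq (p.2 i) (last_ord n_gt0) => p2i p0.
have : (p.2 i < last_ord n_gt0)%N.
  by move: p2i; rewrite -val_eqE /=; have := ltn_ord (p.2 i); lia.
by move=> /(beta_ltn n_gt0 p.1); rewrite p0 ltn0.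
Qed.

(** The summand is symmetric in the beta numbers of w, so that n! times the sum is the sum
    over all permuted sequences. *)
Lemma slater_orthogonal_congruent u v (t : int) :
  n%:Z * t = (\sum_j beta u (j : 'I_n))%N%:Z - (\sum_j beta v (j : 'I_n))%N%:Z ->
  \sum_(w : weight n k) char_val w u * conjc (char_val w v)
  = (n * N ^ n.-1)%:R *+ (u == v).
Proof.
move=> nt; pose f (x : 'I_n -> nat) :=
  slater x (fun j => beta u j) * conjc (slater x (fun j => beta v j)).
have fact0 : (n`!%:R : R[i]) != 0 by rewrite pnatr_eq0 -lt0n fact_gt0.
apply: (mulfI fact0).
transitivity (\sum_(p : weight n k * 'S_n) f (fun i => beta p.1 (p.2 i))).
  rewrite -(pair_bigA _ (fun w (s : 'S_n) => f (fun i => beta w (s i)))) /= mulr_sumr.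
  apply: eq_bigr => w _; rewrite (eq_bigr (fun _ => f (fun i => beta w i))) => [|s _].
    by rewrite sumr_const card_Sn mulr_natl.
  rewrite /f (slater_perm (fun i => beta w i)) (slater_perm (fun i => beta w i)).
  rewrite rmorphM rmorph_sign mulrACA -expr2 -exprM mulnC exprM sqrrN expr1n.
  by rewrite expr1n mul1r.
rewrite sum_slater_rooted => [|x i j ij xij]; last first.
  by rewrite /f (slater_not_injective _ ij xij) mul0r.
under eq_bigr do rewrite (sum_rooted_slater _ nt).
rewrite sumr_const card_ord; case: (u == v); last by rewrite !mulr0n mulr0 mul0rn.
by rewrite !mulr1n -natrM -[LHS]mulr_natr -natrM -mulnA [(_ * n)%N]mulnC.
Qed.

(** Rotating w, the simple current action of the cyclic group, multiplies the summand by the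
    root of unity om of order dividing n, here different from 1. *)
Lemma slater_orthogonal_incongruent u v :
  ~~ (n%:Z %| (\sum_j beta u (j : 'I_n))%N%:Z - (\sum_j beta v (j : 'I_n))%N%:Z)%Z ->
  \sum_(w : weight n k) char_val w u * conjc (char_val w v) = 0.
Proof.
set su := (\sum_j _)%N; set sv := (\sum_j _)%N => ndvd; set S := \sum_w _.
pose om := zeta R M (N%:Z * su%:Z) * conjc (zeta R M (N%:Z * sv%:Z)).
have om1 : om != 1.
  rewrite /om conj_zeta -zetaD zeta_eq1 //; apply: contra ndvd.
  by rewrite -mulrBr /M mulnC PoszM dvdz_mul2l //; rewrite eqz_nat -lt0n.
suff : (om - 1) * S = 0 by move/eqP; rewrite mulf_eq0 subr_eq0 (negbTE om1) => /eqP.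
rewrite mulrBl mul1r; apply/eqP; rewrite subr_eq0; apply/eqP.
rewrite {2}/S (reindex_inj (@rotate_inj n k)) /= mulr_sumr; apply: eq_bigr => w _.
have rotE e : slater (fun i => beta (rotate w) i) e
    = zeta R M (N%:Z * (\sum_j e j)%N%:Z) * ((-1) ^+ perm (@ord_pred_inj n)
       * slater (fun i => beta w i) e).
  rewrite -(slater_shift _ _ (w (last_ord n_gt0)).+1).
  have rotf : (fun j : 'I_n => beta (rotate w) j + (w (last_ord n_gt0)).+1)%N
    = (fun j : 'I_n => beta w (perm (@ord_pred_inj n) j)
                + (if j == Ordinal n_gt0 then N else 0))%N.
    by apply: funext => j; rewrite (beta_rotate n_gt0) permE -val_eqE.
  by rewrite rotf slater_wrap (slater_perm (fun i => beta w i)).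
rewrite /char_val !rotE -/su -/sv !rmorphM rmorph_sign /= /om.
set a := zeta _ _ _; set b := conjc _; set c := (-1) ^+ _; set d := slater _ _; set e := conjc _.
have cc : c * c = 1 by rewrite /c -signr_addb addbb.
by rewrite -[RHS]/(a * (c * d) * (b * (c * e))) -[in LHS](mulr1 (a * b)) -cc; ring.
Qed.

(** This is the unitarity of the S-matrix. The two cases need different arguments because
    the summand is a function of the beta numbers of w modulo N only if n divides the
    difference of the sums of beta numbers of u and v. *)
Lemma slater_orthogonal u v :
  \sum_(w : weight n k) char_val w u * conjc (char_val w v)
  = (n * N ^ n.-1)%:R *+ (u == v).
Proof.
have [/dvdzP [t]|ndvd] :=
  boolP (n%:Z %| (\sum_j beta u (j : 'I_n))%N%:Z - (\sum_j beta v (j : 'I_n))%N%:Z)%Z.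
  by rewrite mulrC => /esym/slater_orthogonal_congruent.
rewrite slater_orthogonal_incongruent //; case: eqP ndvd => // ->.
by rewrite subrr dvdz0.
Qed.
End Orthogonality.

(** * The modular S-matrix *)
Section SMatrix.
Variables (R : realType) (n k : nat).
Hypothesis n_gt0 : (0 < n)%N.
Let N := (k + n)%N.
Let M := (n * N)%N.
Implicit Types m s : state n.

Definition smx_const : R[i] :=
  cis (pi * (n * n.-1)%:R / 4) / ((Num.sqrt (n * (k + n) ^ n.-1)%:R)%:C)%C.

Lemma half_mul_predK : ((n * n.-1)./2.*2 = n * n.-1)%N.
Proof.
by rewrite -[RHS]odd_double_half oddM; case: n => // p /=; rewrite andNb.
Qed.

Lemma sum_subn_ord : ((\sum_(j < n) (n.-1 - j)).*2 = n * n.-1)%N.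
Proof.
have -> : (\sum_(j < n) (n.-1 - j) = \sum_(j < n) j)%N.
  rewrite [RHS](reindex_inj rev_ord_inj); apply: eq_bigr => j _ /=.
  by have := ltn_ord j; lia.
by rewrite -(big_mkord predT (fun j => j)) bin2_sum bin2 half_mul_predK.
Qed.

Lemma sumn_partition_of m :
  sumn (partition_of m) = (\sum_(j < n) nth 0%N (partition_of m) j)%N.
Proof.
rewrite sumnE (big_nth 0%N) size_mkseq big_mkord.
have -> : (\sum_(j < n) nth 0 (partition_of m) j =
           \sum_(j < n.-1.+1) nth 0 (partition_of m) j)%N by rewrite prednK.
by rewrite big_ord_recr /= [X in _ = (_ + X)%N]nth_default ?size_mkseq ?addn0.
Qed.

Lemma partition_vec_rho m i :
  (partition_vec R m + rho R n) 0 i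
  = (beta m i)%:R - (\sum_(j < n) beta m j)%:R / n%:R.
Proof.
have nR : (n%:R : R) != 0 by rewrite pnatr_eq0 -lt0n.
have sum_beta : (\sum_(j < n) beta m j)%N%:R
    = (sumn (partition_of m))%:R + n%:R * (n%:R - 1) / 2 :> R.
  under eq_bigr do rewrite beta_partition.
  rewrite big_split /= -sumn_partition_of natrD; congr (_ + _).
  have := congr1 (fun a => a%:R : R) sum_subn_ord; rewrite -muln2 !natrM -subn1 natrB //.
  by move=> <-; field.
rewrite !mxE beta_partition sum_beta natrD natrB; last by have := ltn_ord i; lia.
rewrite -subn1 natrB // -!natr1; field.
by rewrite nR.
Qed.

Lemma perm_actE (w : 'S_n) (v : 'rV[R]_n) i : perm_act w v 0 i = v 0 ((w^-1)%g i).
Proof.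
rewrite summxE (bigD1 ((w^-1)%g i)) //= !mxE permKV !eqxx mulr1 big1 ?addr0 // => j.
rewrite -(inj_eq (@perm_inj _ w)) permKV => /negbTE wj.
by rewrite !mxE eqxx eq_sym wj mulr0.
Qed.

(** The coordinates of s + rho add up to 0, so the second vector may be replaced by the
    beta numbers of m in the scalar product, and the exponential of the latter becomes
    a monomial in the nodes of s. *)
Lemma SmxE m s : Smx R k m s = smx_const * char_val R k s m.
Proof.
rewrite /Smx -/smx_const; congr (_ * _).
rewrite /char_val /slater /alternant /determinant (reindex_inj invg_inj) /=.
apply: eq_bigr => w _; rewrite odd_permV; congr (_ * _).
pose xs (i : 'I_n) : R := (beta s i)%:R; pose ms (i : 'I_n) : R := (beta m (w i))%:R.
pose S : R := (\sum_(j < n) beta s j)%N%:R.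
transitivity (zeta R M (\sum_(i < n) ((\sum_(j < n) beta s j)%N%:Z - n%:Z * (beta s i)%:Z)
                           * (beta m (w i))%:Z)).
  have nR : (n%:R : R) != 0 by rewrite pnatr_eq0 -lt0n.
  have NR : (N%:R : R) != 0 by rewrite pnatr_eq0 -lt0n /N; lia.
  have -> : dot (partition_vec R s + rho R n) (perm_act w^-1 (partition_vec R m + rho R n))
      = \sum_i (xs i - S / n%:R) * ms i.
    transitivity (\sum_i (xs i - S / n%:R) * (ms i - (\sum_(j < n) beta m j)%:R / n%:R)).
      by apply: eq_bigr => i _; rewrite perm_actE invgK !partition_vec_rho.
    under eq_bigr do rewrite mulrBr.
    rewrite sumrB -mulr_suml [X in _ - X * _](_ : _ = 0) ?mul0r ?subr0 //.
    by rewrite sumrB sumr_const card_ord -[(S / n%:R) *+ n]mulr_natr mulfVK // /S natr_sum subrr.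
  rewrite /zeta; congr cis; rewrite rmorph_sum !mulr_sumr; apply: eq_bigr => i _ /=.
  rewrite intrM rmorphB /= intrM -!pmulrn /M natrM -/N -/(xs i) -/(ms i) -/S.
  by field; rewrite nR NR.
rewrite zeta_sum; apply: eq_bigr => i _; rewrite !mxE.
by rewrite zetaMn.
Qed.

(** Complementing a partition in the rectangle with n rows and lambda_1 columns, with the
    rows in reverse order, gives the dual weight. *)
Lemma beta_dual m (j : 'I_n) :
  (beta (dual_state m) j + beta m (rev_ord j) = beta m 0)%N.
Proof.
pose f (i : 'I_n) := ordS (rev_ord i).
have f_inj : injective f by move=> a b /ordS_inj/rev_ord_inj.
have fE i : f i = (if i == 0%N :> nat then 0 else n - i)%N :> nat.
  by rewrite /f val_ordS /=; have := ltn_ord i; do 2 case: eqP; lia.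
rewrite [RHS](bigID (fun i : 'I_n => (rev_ord j < i)%N)) /= addnC; congr addn.
  by apply: eq_bigl => i; have := ltn_ord j; lia.
rewrite [RHS](reindex_inj f_inj); apply: eq_big => [i|i _]; last by rewrite ffunE.
rewrite fE /=; have := ltn_ord i; have := ltn_ord j.
by case: eqP; lia.
Qed.

(** The nodes have modulus 1 and product 1, so conjugation replaces an exponent e by B - e for
    any bound B; the sign comes from reversing the columns. *)
Lemma char_val_dual s m :
  char_val R k s (dual_state m) = (-1) ^+ (n * n.-1)./2 * conjc (char_val R k s m).
Proof.
rewrite -sign_rev_perm; set y := node R k (fun i : 'I_n => beta s i).
have y0 i : y i != 0 by apply: zeta_neq0.
have -> : conjc (char_val R k s m) = alternant y (fun j => beta m 0 - beta m j)%N.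
  rewrite /char_val /slater /alternant -det_map_mx.
  transitivity (\det (diag_mx (\row_i y i ^+ beta m 0) *m (\matrix_(i, j) (y i)^-1 ^+ beta m j))).
    rewrite det_mulmx det_diag.
    have -> : \prod_i (\row_i y i ^+ beta m 0) 0 i = 1.
      under eq_bigr do rewrite mxE.
      by rewrite prodrXl (prod_node R k) expr1n.
    rewrite mul1r; congr (\det _); apply/matrixP => i j; rewrite !mxE.
    exact: conj_nodeX.
  congr (\det _); rewrite mul_diag_mx; apply/matrixP => i j; rewrite !mxE.
  have jm : (beta m j <= beta m 0)%N by rewrite -(beta_dual m (rev_ord j)) rev_ordK leq_addl.
  by rewrite -{1}(subnK jm) exprD -mulrA -exprMn mulfV ?expr1n ?mulr1.
rewrite -alternant_perm /char_val /slater -/y; apply: eq_alternant => j /=.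
by rewrite permE -(beta_dual m j) addnK.
Qed.

Lemma beta_vacuum (j : nat) : beta (vacuum n k) j = (n.-1 - j)%N.
Proof.
rewrite beta_partition nth_partition_of big1 // => i ji.
by rewrite ffunE ifF //; lia.
Qed.

Fact vacuum_level : (\sum_i vacuum n k i)%N == k.
Proof.
rewrite (bigD1 (Ordinal n_gt0)) //= ffunE /= big1 ?addn0 // => i.
by rewrite -val_eqE /= ffunE => /negbTE ->.
Qed.
Definition vacuum_weight : weight n k := Weight vacuum_level.

Lemma node_inj (w : weight n k) : injective (node R k (fun i : 'I_n => beta w i)).
Proof.
have M_gt0 : (0 < M)%N by rewrite muln_gt0 n_gt0 /N; lia.
move=> i j /eqP; rewrite -subr_eq0 => /eqP yij.
have : zeta R M (n%:Z * ((beta w j)%:Z - (beta w i)%:Z)) = 1.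
  apply: (mulIf (zeta_neq0 R M ((\sum_(j < n) beta w j)%N%:Z - n%:Z * (beta w j)%:Z))).
  rewrite mul1r -zetaD; apply/eqP; rewrite -subr_eq0 -yij /node; apply/eqP.
  by congr (zeta _ _ _ - _); move: (\sum_(a < n) beta w a)%N => S; lia.
move/eqP; rewrite zeta_eq1 // PoszM dvdz_mul2l; last by rewrite eqz_nat -lt0n.
have bi := beta_lt n_gt0 w i; have bj := beta_lt n_gt0 w j.
move=> /dvdzP [q dq]; have q0 : q = 0.
  have N_gt0 : 0 < N%:Z by lia.
  have q_gt : - N%:Z < q * N%:Z by rewrite -dq; lia.
  have q_lt : q * N%:Z < N%:Z by rewrite -dq; lia.
  move: q_gt q_lt; rewrite -mulN1r ltr_pM2r // => q_gt.
  by rewrite -[X in _ < X]mul1r ltr_pM2r //; lia.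
apply: val_inj => /=; case: (ltngtP i j) => // /(beta_ltn n_gt0 w); move: dq; rewrite q0; lia.
Qed.

Lemma char_val_vacuum_neq0 (w : weight n k) : char_val R k w (vacuum n k) != 0.
Proof.
rewrite /char_val /slater; set y := node _ _ _.
have -> : alternant y (fun j => beta (vacuum n k) j)
    = (-1) ^+ rev_perm n * alternant y (fun j => j).
  by rewrite -alternant_perm; apply: eq_alternant => j; rewrite beta_vacuum /= permE /=; lia.
rewrite mulf_neq0 ?signr_eq0 //.
have -> : alternant y (fun j => j) = \det (Vandermonde n (\row_i y i)).
  by rewrite /alternant -det_tr; congr (\det _); apply/matrixP => i j; rewrite !mxE.
rewrite det_Vandermonde; apply/prodf_neq0 => i _; apply/prodf_neq0 => j ij.
by rewrite !mxE subr_eq0 (inj_eq (@node_inj w)) -val_eqE /= gtn_eqF.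
Qed.

(** The phase of the normalisation is chosen so that its square cancels the sign in
    [char_val_dual]. *)
Lemma smx_const_sqr : smx_const ^+ 2 * (-1) ^+ (n * n.-1)./2 = ((n * N ^ n.-1)%:R)^-1.
Proof.
rewrite /smx_const exprMn exprVn -rmorphXn /= sqr_sqrtr ?ler0n //.
rewrite -cisMn rmorph_nat mulrAC [X in X / _](_ : _ = 1) ?mul1r //.
have -> : pi * (n * n.-1)%:R / 4 * 2%:R = pi * (n * n.-1)./2%:R :> R.
  by have := half_mul_predK; set T := (n * n.-1)./2 => <-; rewrite -muln2 natrM; field.
by rewrite cisMn cis_pi -exprMn mulrNN mul1r expr1n.
Qed.

Lemma smx_const_neq0 : smx_const != 0.
Proof.
apply/eqP => c0; have := smx_const_sqr; rewrite c0 expr0n mul0r => /esym/eqP.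
by rewrite invr_eq0 pnatr_eq0 muln_eq0 expn_eq0 /N; lia.
Qed.

Lemma verlindeE (l m v : weight n k) :
  verlinde R l m v = ((n * N ^ n.-1)%:R)^-1 *
    \sum_(s : weight n k) char_val R k s l * char_val R k s m / char_val R k s (vacuum n k)
                          * conjc (char_val R k s v).
Proof.
rewrite /verlinde mulr_sumr; apply: eq_bigr => s _; rewrite !SmxE char_val_dual -smx_const_sqr.
have := smx_const_neq0; have := char_val_vacuum_neq0 s.
move: smx_const (char_val R k s (vacuum n k)) => c d d0 c0.
by field; rewrite c0 d0.
Qed.
End SMatrix.

(** * The combinatorial algebra *)
Section CombinatorialAlgebra.
Variables (R : realType) (n k : nat).
Hypothesis n_ge2 : (2 <= n)%N.
Let N := (k + n)%N.
Let n_gt0 : (0 < n)%N := ltnW n_ge2.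
Local Notation H := (level_space R[i] n k).
Implicit Types (u v : H) (s w : weight n k).

Lemma level_val_sum (I : Type) (r : seq I) (P : pred I) (f : I -> H) :
  level_val (\sum_(i <- r | P i) f i) = \sum_(i <- r | P i) level_val (f i).
Proof. exact: (raddf_sum (\val : H -> fock R[i] n)). Qed.

Definition chi s v : R[i] := eigenfun k (node R k (fun i : 'I_n => beta s i)) v.

Lemma chiP s a u v : chi s (a *: u + v) = a * chi s u + chi s v.
Proof. by rewrite /chi /= eigenfunD eigenfunZ. Qed.

Lemma chiZ s a v : chi s (a *: v) = a * chi s v.
Proof. by rewrite /chi /= eigenfunZ. Qed.

Lemma chi_wket s w : chi s (wket R[i] w) = char_val R k s w.
Proof. exact: eigenfun_ket. Qed.

Lemma chi_sum s (I : Type) (r : seq I) (P : pred I) (f : I -> H) :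
  chi s (\sum_(i <- r | P i) f i) = \sum_(i <- r | P i) chi s (f i).
Proof. by rewrite /chi level_val_sum eigenfun_sum. Qed.

Lemma chi_inversion v w :
  \sum_s chi s v * conjc (char_val R k s w)
  = (n * N ^ n.-1)%:R * (level_val v)@_(w : state n).
Proof.
under eq_bigr do rewrite mulr_suml.
rewrite exchange_big (bigD1 w) //= [X in _ + X]big1 ?addr0 => [|w' w'w].
  under eq_bigr do rewrite -mulrA.
  by rewrite -mulr_sumr slater_orthogonal // eqxx mulrC.
under eq_bigr do rewrite -mulrA.
by rewrite -mulr_sumr slater_orthogonal // (negbTE w'w) mulr0n mulr0.
Qed.

(** Up to normalisation the chi s are algebra homomorphisms, by [chi_comb_mul] below. As they
    separate the points of the level space, the algebra axioms need only be checked on their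
    values. *)
Lemma chi_inj u v : (forall s, chi s u = chi s v) -> u = v.
Proof.
move=> uv; apply: val_inj; rewrite /= (level_expand (level_valP u)) (level_expand (level_valP v)).
apply: eq_bigr => w _; congr (_ *: _).
have c0 : ((n * N ^ n.-1)%:R : R[i]) != 0.
  by rewrite pnatr_eq0 muln_eq0 expn_eq0 /N; lia.
apply: (mulfI c0); rewrite -!chi_inversion.
by apply: eq_bigr => s _; rewrite uv.
Qed.

Lemma chi_schur s w v :
  chi s (level_op (partition_of w) v) = char_val R k s w * chi s v / char_val R k s (vacuum n k).
Proof.
have vac0 := char_val_vacuum_neq0 R n_gt0 s.
apply: (mulfI vac0); rewrite mulrCA mulfV // mulr1.
rewrite -(eigenfun_schur n_ge2 (prod_node R k _) _ w (level_valP v)) => [|i j].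
  by congr (_ * _); apply: eq_alternant => j; rewrite beta_vacuum.
by rewrite !(node_exp R k n_gt0).
Qed.

Lemma chi_comb_mul s u v :
  chi s (comb_mul u v) = chi s u * chi s v / char_val R k s (vacuum n k).
Proof.
rewrite /comb_mul chi_sum -mulrA /chi [X in _ = X * _]/eigenfun mulr_suml.
apply: eq_bigr => w _; rewrite -!/(chi s _).
by rewrite chiZ chi_schur !mulrA.
Qed.

Definition vacuum_ket : H := wket R[i] (vacuum_weight k n_gt0).

Lemma chi_vacuum_ket s : chi s vacuum_ket = char_val R k s (vacuum n k).
Proof. exact: chi_wket. Qed.

Lemma comb_mul1l : left_id vacuum_ket (@comb_mul R[i] n k).
Proof.
move=> v; apply: chi_inj => s; rewrite chi_comb_mul chi_vacuum_ket mulrC mulKf //.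
exact: char_val_vacuum_neq0.
Qed.

Lemma comb_mul1r : right_id vacuum_ket (@comb_mul R[i] n k).
Proof.
move=> v; apply: chi_inj => s; rewrite chi_comb_mul chi_vacuum_ket mulfK //.
exact: char_val_vacuum_neq0.
Qed.

Lemma comb_mul_linear_l a u u' v :
  comb_mul (a *: u + u') v = a *: comb_mul u v + comb_mul u' v.
Proof. by apply: chi_inj => s; rewrite !(chiP, chi_comb_mul) !mulrDl !mulrA. Qed.

Lemma comb_mul_linear_r a u v v' :
  comb_mul u (a *: v + v') = a *: comb_mul u v + comb_mul u v'.
Proof.
by apply: chi_inj => s; rewrite !(chiP, chi_comb_mul) mulrDr mulrDl mulrCA !mulrA.
Qed.

Lemma comb_mulA : associative (@comb_mul R[i] n k).
Proof.
move=> u v v'; apply: chi_inj => s.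
by rewrite !chi_comb_mul !mulrA; congr (_ / _); rewrite mulrAC.
Qed.

Lemma comb_mul_unital_algebra : unital_algebra (@comb_mul R[i] n k).
Proof.
split=> [v a u u'|u a v v'||].
- exact: comb_mul_linear_l.
- exact: comb_mul_linear_r.
- exact: comb_mulA.
by exists vacuum_ket; split; [apply: comb_mul1l|apply: comb_mul1r].
Qed.

Lemma comb_mul_verlinde (l m : weight n k) :
  comb_mul (wket R[i] l) (wket R[i] m) = \sum_(v : weight n k) verlinde R l m v *: wket R[i] v.
Proof.
apply: val_inj; rewrite [LHS](level_expand (level_valP _)) [RHS]level_val_sum.
apply: eq_bigr => v _; congr (_ *: _).
rewrite verlindeE //.
have c0 : ((n * N ^ n.-1)%:R : R[i]) != 0.
  by rewrite pnatr_eq0 muln_eq0 expn_eq0 /N; lia.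
apply: (mulfI c0); rewrite -chi_inversion mulrA mulfV // mul1r.
by apply: eq_bigr => s _; rewrite chi_comb_mul !chi_wket.
Qed.
End CombinatorialAlgebra.

(** * Integrality *)
Section Integrality.
Variables (K : fieldType) (n : nat).
Implicit Types (c : K) (v : fock K n) (f g : endo (fock K n)).

Definition is_integer c := exists z : int, c = z%:~R.

Lemma is_integer0 : is_integer 0. Proof. by exists 0. Qed.
Lemma is_integer1 : is_integer 1. Proof. by exists 1. Qed.
Lemma is_integerD c d : is_integer c -> is_integer d -> is_integer (c + d).
Proof. by move=> [a ->] [b ->]; exists (a + b); rewrite rmorphD. Qed.
Lemma is_integerN c : is_integer c -> is_integer (- c).
Proof. by move=> [a ->]; exists (- a); rewrite rmorphN. Qed.
Lemma is_integerM c d : is_integer c -> is_integer d -> is_integer (c * d).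
Proof. by move=> [a ->] [b ->]; exists (a * b); rewrite rmorphM. Qed.

Definition integral v := forall m, is_integer v@_m.
Definition integral_endo f := forall v, integral v -> integral (f v).

Lemma integral0 : integral 0.
Proof. by move=> m; rewrite mcoeff0; apply: is_integer0. Qed.

Lemma integral_ket m : integral (ket K m).
Proof.
by move=> m'; rewrite mcoeff_ket; case: eqP => _; [apply: is_integer1|apply: is_integer0].
Qed.

Lemma integral_endo0 : integral_endo 0.
Proof. by move=> v _; apply: integral0. Qed.
Lemma integral_endo1 : integral_endo 1.
Proof. by []. Qed.
Lemma integral_endoD f g : integral_endo f -> integral_endo g -> integral_endo (f + g).
Proof.
by move=> fi gi v vi m; rewrite endoDE mcoeffD; apply: is_integerD; [apply: fi|apply: gi].
Qed.
Lemma integral_endoN f : integral_endo f -> integral_endo (- f).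
Proof. by move=> fi v vi m; rewrite endoNE mcoeffN; apply/is_integerN/fi. Qed.
Lemma integral_endoM f g : integral_endo f -> integral_endo g -> integral_endo (f * g).
Proof. by move=> fi gi v /gi/fi. Qed.

Lemma ket_expand v : v = \sum_(m <- msupp v) v@_m *: ket K m.
Proof.
rewrite {1}[v]monalgE; apply: eq_bigr => m _.
by apply/malgP => m'; rewrite mcoeffZ /ket !mcoeffU mulrnAr mulr1.
Qed.

Lemma integral_hop i : integral_endo (hop K i).
Proof.
move=> v vi m; rewrite [v]ket_expand linear_sum mcoeff_sum.
apply: (big_ind is_integer) => [||m' _]; [exact: is_integer0|exact: is_integerD|].
rewrite linearZ mcoeffZ; apply: is_integerM => //.
suff hop_ket : integral (hop K i (ket K m')) by apply: hop_ket.
by rewrite hopE; case: ifP => _; [apply: integral0|apply: integral_ket].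
Qed.

Lemma integral_elem_sym r : integral_endo (elem_sym K n r).
Proof.
case: r => r /=; last exact: integral_endo0.
case: ifP => _; first exact: integral_endo1.
apply: (big_ind integral_endo) => [||I _]; [exact: integral_endo0|exact: integral_endoD|].
rewrite /cyclic_prod; case: pickP => [p _|_]; last exact: integral_endo1.
apply: (big_ind integral_endo) => [||i _]; [exact: integral_endo1|exact: integral_endoM|].
exact: integral_hop.
Qed.

Lemma integral_schur lam : integral_endo (schur K n lam).
Proof.
apply: (big_ind integral_endo) => [||s _]; [exact: integral_endo0|exact: integral_endoD|].
apply: integral_endoM.
  by case: (odd_perm s); rewrite ?expr1 ?expr0;
    [apply: integral_endoN|]; apply: integral_endo1.
apply: (big_ind integral_endo) => [||i _]; [exact: integral_endo1|exact: integral_endoM|].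
by rewrite mxE; apply: integral_elem_sym.
Qed.
End Integrality.

(** * The fusion ring *)
Lemma mcoeff_sumU (K : zmodType) (T : finType) (c : T -> K) t :
  (\sum_s << c s *g s >> : {malg K[T]})@_t = c t.
Proof.
rewrite raddf_sum (bigD1 t) //= mcoeffUU big1 ?addr0 // => s st.
by rewrite mcoeffU (negbTE st).
Qed.

Section StructureConstants.
Variables (R : realType) (n k : nat).
Hypothesis n_ge2 : (2 <= n)%N.
Let n_gt0 : (0 < n)%N := ltnW n_ge2.
Local Notation H := (level_space R[i] n k).
Implicit Types (s l m w : weight n k).

Lemma mcoeff_sum_wket (c : weight n k -> R[i]) w :
  (level_val (\sum_v c v *: wket R[i] v))@_(w : state n) = c w.
Proof.
have wketZ v : level_val (c v *: wket R[i] v) = c v *: ket R[i] v by [].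
rewrite level_val_sum; under eq_bigr do rewrite wketZ.
exact: mcoeff_sum_ket.
Qed.

(** The Verlinde numbers are matrix coefficients of s_lambda(a), a polynomial with integer
    coefficients in operators with integer matrices. *)
Lemma verlinde_integer l m w : exists z : int, z%:~R = verlinde R l m w.
Proof.
have [z zE] := integral_schur (partition_of l) (integral_ket R[i] m) w.
exists z; rewrite -zE.
transitivity ((level_val (comb_mul (wket R[i] l) (wket R[i] m)))@_(w : state n)).
  by rewrite comb_mul_wket.
by rewrite comb_mul_verlinde // mcoeff_sum_wket.
Qed.

(** Used twice: for the integers, to move the ring axioms from the level space to the fusion
    ring, and for the complex numbers, to get the isomorphism. *)
Section ScalarExtension.
Variables (K : comNzRingType) (iota : {rmorphism K -> R[i]}).
Hypothesis iota_inj : injective iota.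
Variable C : weight n k -> weight n k -> weight n k -> K.
Hypothesis iota_C : forall l m s, iota (C l m s) = verlinde R l m s.
Implicit Types u v : {malg K[weight n k]}.

Definition realize u : H := \sum_w iota u@_w *: wket R[i] w.

Lemma mcoeff_structure_mul u v s :
  (structure_mul C u v)@_s = \sum_l \sum_m u@_l * v@_m * C l m s.
Proof.
rewrite /structure_mul raddf_sum; apply: eq_bigr => l _.
rewrite raddf_sum; apply: eq_bigr => m _.
exact: mcoeff_sumU.
Qed.

Lemma mcoeff_realize u w : (level_val (realize u))@_(w : state n) = iota u@_w.
Proof. exact: mcoeff_sum_wket. Qed.

Lemma realize_inj : injective realize.
Proof.
move=> u v uv; apply/malgP => w; apply: iota_inj.
by rewrite -!mcoeff_realize uv.
Qed.

Lemma realizeP a u v : realize (a *: u + v) = iota a *: realize u + realize v.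
Proof.
rewrite /realize scaler_sumr -big_split; apply: eq_bigr => w _ /=.
by rewrite mcoeffD mcoeffZ rmorphD rmorphM scalerDl scalerA.
Qed.

Lemma chi_realize s u : chi s (realize u) = \sum_w iota u@_w * char_val R k s w.
Proof. by rewrite chi_sum; apply: eq_bigr => w _; rewrite chiZ chi_wket. Qed.

Lemma realize_structure_mul u v :
  realize (structure_mul C u v) = comb_mul (realize u) (realize v).
Proof.
apply: (chi_inj n_ge2) => s; rewrite chi_comb_mul // !chi_realize.
transitivity (\sum_l \sum_m iota u@_l * iota v@_m
                * chi s (comb_mul (wket R[i] l) (wket R[i] m))).
  under eq_bigr do rewrite mcoeff_structure_mul rmorph_sum mulr_suml.
  rewrite exchange_big; apply: eq_bigr => l _ /=.
  under eq_bigr do rewrite rmorph_sum mulr_suml.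
  rewrite exchange_big; apply: eq_bigr => m _ /=.
  rewrite comb_mul_verlinde // chi_sum mulr_sumr; apply: eq_bigr => w _.
  by rewrite !rmorphM iota_C chiZ chi_wket mulrA.
rewrite mulr_suml mulr_suml; apply: eq_bigr => l _.
rewrite mulr_sumr mulr_suml; apply: eq_bigr => m _.
rewrite chi_comb_mul // !chi_wket; ring.
Qed.

Lemma structure_mul_unital_algebra : unital_algebra (structure_mul C).
Proof.
split=> [v a u u'|u a v v'|u v v'|].
- apply: realize_inj; apply: etrans (realize_structure_mul _ _) _.
  rewrite (realizeP a u u') comb_mul_linear_l // -(realize_structure_mul u v).
  rewrite -(realize_structure_mul u' v); exact/esym/realizeP.
- apply: realize_inj; apply: etrans (realize_structure_mul _ _) _.
  rewrite (realizeP a v v') comb_mul_linear_r // -(realize_structure_mul u v).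
  rewrite -(realize_structure_mul u v'); exact/esym/realizeP.
- apply: realize_inj; apply: etrans (realize_structure_mul _ _) _.
  apply: etrans (congr1 (comb_mul (realize u)) (realize_structure_mul v v')) _.
  rewrite comb_mulA // -(realize_structure_mul u v).
  exact/esym/realize_structure_mul.
have realize1 : realize << vacuum_weight k n_gt0 >> = wket R[i] (vacuum_weight k n_gt0).
  rewrite /realize (bigD1 (vacuum_weight k n_gt0)) //= mcoeffUU rmorph1 scale1r.
  rewrite big1 ?addr0 // => w wv.
  by rewrite mcoeffU eq_sym (negbTE wv) rmorph0 scale0r.
by exists << vacuum_weight k n_gt0 >>; split=> u; apply: realize_inj;
  rewrite realize_structure_mul realize1 ?comb_mul1l ?comb_mul1r.
Qed.
End ScalarExtension.
End StructureConstants.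

Section ScalarComplex.
Variables (R : realType) (n k : nat).

Definition realize_id : {malg R[i][weight n k]} -> level_space R[i] n k :=
  realize (idfun : R[i] -> R[i]).

Fact realize_id_linear : linear realize_id.
Proof. exact: (realizeP (idfun : {rmorphism R[i] -> R[i]})). Qed.
HB.instance Definition _ := GRing.isLinear.Build R[i] {malg R[i][weight n k]}
  (level_space R[i] n k) *:%R realize_id realize_id_linear.

Lemma realize_id_bij : bijective realize_id.
Proof.
pose coords (v : level_space R[i] n k) : {malg R[i][weight n k]} :=
  \sum_(w : weight n k) << (level_val v)@_(w : state n) *g w >>.
have coordsE v (w : weight n k) : (coords v)@_w = (level_val v)@_(w : state n).
  exact: mcoeff_sumU.
exists coords => [u|v].
  apply/malgP => w; rewrite coordsE.
  exact: (mcoeff_realize (idfun : {rmorphism R[i] -> R[i]})).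
apply: val_inj; rewrite [RHS](level_expand (level_valP v)) [LHS]level_val_sum.
by apply: eq_bigr => w _; rewrite -coordsE.
Qed.
End ScalarComplex.

Theorem theorem1p1 (R : realType) (n k : nat) (hn : (2 <= n)%N) (hk : (1 <= k)%N) :
  [/\ unital_algebra (@comb_mul R[i] n k),
      (forall l m : weight n k,
         comb_mul (wket R[i] l) (wket R[i] m)
         = \sum_(v : weight n k) verlinde R l m v *: wket R[i] v)
    & exists N : weight n k -> weight n k -> weight n k -> int,
      [/\ (forall l m v, (N l m v)%:~R = verlinde R l m v),
          unital_algebra (structure_mul N)
        & exists f : {linear {malg R[i][weight n k]} -> level_space R[i] n k},
            bijective f /\
            {morph f : u v / structure_mul (fun l m s => (N l m s)%:~R) u v
                             >-> comb_mul u v}]].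
Proof.
split; [exact: comb_mul_unital_algebra|exact: comb_mul_verlinde|].
pose N (l m v : weight n k) : int := projT1 (cid (verlinde_integer R hn l m v)).
have NE l m v : (N l m v)%:~R = verlinde R l m v by rewrite /N; case: cid.
exists N; split; first exact: NE.
  exact: (structure_mul_unital_algebra hn (iota := intmul 1) (@intr_inj _) NE).
exists (@realize_id R n k); split; first exact: realize_id_bij.
by move=> u v; exact: (realize_structure_mul hn (iota := idfun) NE).
Qed.
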